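(* Let functions $k_i:\Gamma_0\to\mathbb{R}$, $i=1,2$, be measurable. If the function $\widehat{k}(\eta^+,\eta^-):=k_1(\eta^+)k_2(\eta^-)$ is positive definite in the sense of the two-type convolution $\circledast$ on $\Gamma_0^2$, then the function $k=k_1\ast k_2$ is positive definite in the sense of the $\star$-convolution on $\Gamma_0$.
   Context: Let $X$ be a connected oriented non-compact Riemannian $C^\infty$-manifold with Borel $\sigma$-algebra $\mathcal{B}(X)$, and let $\mathcal{B}_{\mathrm c}(X)$ be the class of Borel sets with compact closure. Let $m$ be a non-atomic Radon measure on $X$: $m(\Lambda)<\infty$ for $\Lambda\in\mathcal{B}_{\mathrm c}(X)$ and $m(\{x\})=0$ for $x\in X$. Assume there is an increasing sequence $\Lambda_n\in\mathcal{B}_{\mathrm c}(X)$ with $\bigcup_n\Lambda_n=X$. For $Y\in\mathcal{B}(X)$ and $n\in\mathbb{N}$ let $\Gamma_Y^{(n)}=\{\eta\subset Y: |\eta|=n\}$, where $|\eta|$ is the number of points of $\eta$; $\Gamma_Y^{(0)}=\{\emptyset\}$; $\Gamma^{(n)}=\Gamma^{(n)}_X$. $\Gamma^{(n)}$ is identified with the quotient of $\widetilde{X^n}=\{(x_1,\dots,x_n)\in X^n: x_k\neq x_l \text{ if } k\ne l\}$ by the permutation group $S_n$ and carries the quotient topology. The space of finite configurations is the disjoint union $\Gamma_0=\bigsqcup_{n\ge 0}\Gamma^{(n)}$ with the disjoint-union topology and its Borel $\sigma$-algebra. $\Gamma_0^2=\Gamma_0\times\Gamma_0$ with the product topology and its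 Borel $\sigma$-algebra; its elements are written $(\eta^+,\eta^-)$. Let $m^{(n)}$ be the image on $\Gamma^{(n)}$ of $m^{\otimes n}$ (restricted to $\widetilde{X^n}$) under $(x_1,\dots,x_n)\mapsto\{x_1,\dots,x_n\}$, and $m^{(0)}(\{\emptyset\})=1$. The Lebesgue--Poisson measure is $\lambda=\sum_{n=0}^\infty\frac1{n!}m^{(n)}$ on $\Gamma_0$. $B_{\mathrm{bs}}(\Gamma_0)$ is the set of bounded measurable functions $G:\Gamma_0\to\mathbb{R}$ with bounded support, i.e. vanishing outside $\bigsqcup_{n=0}^N\Gamma_\Lambda^{(n)}$ for some $\Lambda\in\mathcal{B}_{\mathrm c}(X)$, $N\in\mathbb{N}$. $B_{\mathrm{bs}}(\Gamma_0^2)$ is the set of bounded measurable functions $G:\Gamma_0^2\to\mathbb{R}$ vanishing outside $\bigl(\bigsqcup_{n=0}^N\Gamma_\Lambda^{(n)}\bigr)\times\bigl(\bigsqcup_{n=0}^N\Gamma_\Lambda^{(n)}\bigr)$ for some such $\Lambda,N$. For measurable functions on $\Gamma_0$: $(G_1\ast G_2)(\eta)=\sum_{\xi\subset\eta}G_1(\xi)G_2(\eta\setminus\xi)$ and $$(G_1\star G_2)(\eta)=\sum_{\xi_1\sqcup\xi_2\sqcup\xi_3=\eta}G_1(\xi_1\cup\xi_2)\,G_2(\xi_2\cup\xi_3),$$ where the sum is over all ordered partitions of $\eta$ into three disjoint (possibly empty) parts. For measurable functions on $\Gamma_0^2$: $$(G_1\circledast G_2)(\eta^+,\eta^-)=\sum_{\substack{\xi_1^+\sqcup\xi_2^+\sqcup\xi_3^+=\eta^+\\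 \xi_1^-\sqcup\xi_2^-\sqcup\xi_3^-=\eta^-}}G_1(\xi_1^+\cup\xi_2^+,\xi_1^-\cup\xi_2^-)\,G_2(\xi_2^+\cup\xi_3^+,\xi_2^-\cup\xi_3^-).$$ A measurable $k:\Gamma_0\to\mathbb{R}$ is positive definite in the sense of the $\star$-convolution if $\int_{\Gamma_0}(G\star G)(\eta)\,k(\eta)\,d\lambda(\eta)\ge0$ for all $G\in B_{\mathrm{bs}}(\Gamma_0)$. A measurable $k:\Gamma_0^2\to\mathbb{R}$ is positive definite in the sense of the $\circledast$-convolution if $\int_{\Gamma_0^2}(G\circledast G)(\eta^+,\eta^-)\,k(\eta^+,\eta^-)\,d\lambda(\eta^+)d\lambda(\eta^-)\ge0$ for all $G\in B_{\mathrm{bs}}(\Gamma_0^2)$. (In both definitions the integrals are understood to be well defined.) *)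

(* Defs.v *)
From HB Require Import structures.
From mathcomp Require Import all_boot all_order all_algebra finmap.
From mathcomp Require Import all_classical all_reals all_analysis.

Set Implicit Arguments.
Unset Strict Implicit.
Unset Printing Implicit Defensive.

Import Order.TTheory GRing.Theory Num.Theory.
Import numFieldNormedType.Exports.

Local Open Scope classical_set_scope.
Local Open Scope ring_scope.

(* [U] is meant to be open. *)
Fixpoint Ck_on (R : realType) (d k : nat) (U : set 'rV[R]_d)
    (f : 'rV[R]_d -> R) : Prop :=
  (forall v, U v -> {for v, continuous f}) /\
  if k is k'.+1 then
    forall j : 'I_d, (forall v, U v -> derivable f v (delta_mx 0 j)) /\
      Ck_on k' U (fun v => 'D_(delta_mx 0 j) f v)
  else True.

Definition smooth_on (R : realType) (d : nat) (U : set 'rV[R]_d)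
    (f : 'rV[R]_d -> R) : Prop :=
  forall k, Ck_on k U f.

Record chart (R : realType) (d : nat) (X : ptopologicalType) := Chart {
  chart_dom : set X;
  chart_cod : set 'rV[R]_d;
  chart_fun : X -> 'rV[R]_d;
  chart_inv : 'rV[R]_d -> X;
  chart_dom_open : open chart_dom;
  chart_cod_open : open chart_cod;
  chart_funS : forall x, chart_dom x -> chart_cod (chart_fun x);
  chart_invS : forall v, chart_cod v -> chart_dom (chart_inv v);
  chart_funK : forall x, chart_dom x -> chart_inv (chart_fun x) = x;
  chart_invK : forall v, chart_cod v -> chart_fun (chart_inv v) = v;
  chart_fun_continuous : forall x, chart_dom x -> {for x, continuous chart_fun};
  chart_inv_continuous : forall v, chart_cod v -> {for v, continuous chart_inv}
}.

Definition transition (R : realType) (d : nat) (X : ptopologicalType)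
    (c1 c2 : chart R d X) : 'rV[R]_d -> 'rV[R]_d :=
  chart_fun c2 \o chart_inv c1.

Definition transition_dom (R : realType) (d : nat) (X : ptopologicalType)
    (c1 c2 : chart R d X) : set 'rV[R]_d :=
  chart_cod c1 `&` chart_inv c1 @^-1` chart_dom c2.

(* The orientation is given by an oriented smooth atlas and the metric by its
   Gram matrices in the charts of that atlas.  Tangent vectors are rows, so that
   the differential of a transition map [tau] is [u |-> u *m 'J tau v]. *)
Record oriented_riemannian_manifold (R : realType) (d : nat)
    (X : ptopologicalType) := OrientedRiemannianManifold {
  mfd_hausdorff : hausdorff_space X;
  mfd_second_countable : @second_countable X;
  mfd_index : Type;
  mfd_chart : mfd_index -> chart R d X;
  mfd_cover : forall x, exists i, chart_dom (mfd_chart i) x;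
  mfd_smooth : forall i j (l : 'I_d),
    smooth_on (transition_dom (mfd_chart i) (mfd_chart j))
      (fun v => transition (mfd_chart i) (mfd_chart j) v 0 l);
  mfd_oriented : forall i j v,
    transition_dom (mfd_chart i) (mfd_chart j) v ->
    0 < \det ('J (transition (mfd_chart i) (mfd_chart j)) v);
  mfd_metric : mfd_index -> 'rV[R]_d -> 'M[R]_d;
  mfd_metric_smooth : forall i (a b : 'I_d),
    smooth_on (chart_cod (mfd_chart i)) (fun v => mfd_metric i v a b);
  mfd_metric_sym : forall i v, chart_cod (mfd_chart i) v ->
    (mfd_metric i v)^T = mfd_metric i v;
  mfd_metric_pos : forall i v (u : 'rV[R]_d), chart_cod (mfd_chart i) v ->
    u != 0 -> 0 < (u *m mfd_metric i v *m u^T) 0 0;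
  mfd_metric_compat : forall i j v,
    transition_dom (mfd_chart i) (mfd_chart j) v ->
    let tau := transition (mfd_chart i) (mfd_chart j) in
    mfd_metric i v = 'J tau v *m mfd_metric j (tau v) *m ('J tau v)^T
}.

Notation borel X := (g_sigma_algebraType (@open X)).

Definition Bc (X : ptopologicalType) : set (set X) :=
  [set L | measurable (L : set (borel X)) /\ compact (closure L)].

Definition radon (R : realType) (X : ptopologicalType)
    (m : set (borel X) -> \bar R) : Prop :=
  forall L, Bc L -> (m L < +oo)%E.

Definition non_atomic (R : realType) (X : ptopologicalType)
    (m : set (borel X) -> \bar R) : Prop :=
  forall x : X, m [set x] = 0%E.

Definition fconf (X : choiceType) : Type := {fset X}.

HB.instance Definition _ (X : choiceType) := Choice.on (fconf X).
HB.instance Definition _ (X : choiceType) :=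
  isPointed.Build (fconf X) (fset0 : {fset X}).

Definition conf_of_tuple (X : choiceType) (n : nat) (t : n.-tuple X) :
  fconf X := [fset x | x in tval t]%fset.

Section fconf_topology.
Variable X : topologicalType.

(* A set of configurations is open in the disjoint union of the quotients of
   the spaces of n-tuples of distinct points iff for every [n] its preimage
   under [conf_of_tuple] is the trace on those tuples of an open set of X^n. *)
Definition fconf_open : set (set (fconf X)) :=
  [set U | forall n, exists2 V : set (prod_topology (fun _ : 'I_n => X)),
     open V & forall t : n.-tuple X, uniq t ->
       (U (conf_of_tuple t) <-> V (tnth t))].

Lemma fconf_openT : fconf_open setT.
Proof. by move=> n; exists setT => //; exact: openT. Qed.

Lemma fconf_openI : setI_closed fconf_open.
Proof.
move=> A B oA oB n; have [V oV VA] := oA n; have [W oW WB] := oB n.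
exists (V `&` W); first exact: openI.
by move=> t ut; split=> -[]; [move=> /(VA _ ut) At /(WB _ ut)|
  move=> /(VA _ ut) At /(WB _ ut)].
Qed.

Lemma fconf_open_bigcup (I : Type) (f : I -> set (fconf X)) :
  (forall i, fconf_open (f i)) -> fconf_open (\bigcup_i f i).
Proof.
move=> of_ n.
have /choice[V VP] : forall i, exists V : set (prod_topology (fun _ : 'I_n => X)),
    open V /\ forall t : n.-tuple X, uniq t ->
      (f i (conf_of_tuple t) <-> V (tnth t)).
  by move=> i; have [V oV VP] := of_ i n; exists V.
exists (\bigcup_i V i).
  by apply: bigcup_open => i _; case: (VP i).
by move=> t ut; split=> -[i _ it]; exists i => //;
  apply/((VP i).2 _ ut).
Qed.

HB.instance Definition _ := isOpenTopological.Build (fconf X)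
  fconf_openT fconf_openI fconf_open_bigcup.

End fconf_topology.

Definition conf_upto (X : choiceType) (L : set X) (N : nat) :
  set (fconf X) := [set eta | [set` eta] `<=` L /\ (#|` eta| <= N)%N].

Section lebesgue_poisson.
Variables (R : realType) (X : ptopologicalType).
Variable m : set (borel X) -> \bar R.

(* X^n carries the product sigma-algebra, which is its Borel sigma-algebra since
   manifolds are second countable.  As with the library's [\x], these are set
   functions defined for every [m]; they are measures when [m] is a sigma-finite
   measure and [X] is second countable and Hausdorff. *)
Fixpoint power_measure (n : nat) : set (n.-tuple (borel X)) -> \bar R :=
  match n return set (n.-tuple (borel X)) -> \bar R with
  | 0 => dirac [tuple]
  | n'.+1 => pushforward (m \x @power_measure n')%E
               (fun p : borel X * n'.-tuple (borel X) =>
                  [tuple of p.1 :: p.2])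
  end.

Definition conf_measure (n : nat) (A : set (borel (fconf X))) : \bar R :=
  power_measure
    [set t : n.-tuple (borel X) | uniq t /\ A (@conf_of_tuple X n t)].

Definition lebesgue_poisson (A : set (borel (fconf X))) : \bar R :=
  (\sum_(0 <= n <oo) (n`!%:R^-1)%:E * conf_measure n A)%E.

End lebesgue_poisson.

Section bounded_support.
Variables (R : realType) (X : ptopologicalType).

Definition Bbs (G : fconf X -> R) : Prop :=
  [/\ measurable_fun setT (G : borel (fconf X) -> R),
      exists M : R, forall eta, `|G eta| <= M &
      exists (L : set X) (N : nat), Bc L /\
        forall eta, ~ conf_upto L N eta -> G eta = 0].

Definition Bbs2 (G : fconf X * fconf X -> R) : Prop :=
  [/\ measurable_fun setT (G : borel (fconf X * fconf X)%type -> R),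
      exists M : R, forall p, `|G p| <= M &
      exists (L : set X) (N : nat), Bc L /\
        forall p, ~ (conf_upto L N `*` conf_upto L N) p -> G p = 0].

End bounded_support.

Section convolutions.
Variables (R : realType) (X : choiceType).
Local Open Scope fset_scope.

Definition parts3 (eta : fconf X) : seq (fconf X * fconf X * fconf X) :=
  [seq ((x1 : fconf X), (x2 : fconf X), (eta `\` x1 `\` x2 : fconf X))
    | x1 <- fpowerset eta, x2 <- fpowerset (eta `\` x1)].

Lemma parts3_uniq eta : uniq (parts3 eta).
Proof.
apply: allpairs_uniq_dep => [|x _|]; [exact: fset_uniq|exact: fset_uniq|].
by move=> [x1 x2] [y1 y2] _ _ /= [] -> ->.
Qed.

Lemma parts3P (eta x1 x2 x3 : fconf X) :
  ((x1, x2, x3) \in parts3 eta) =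
  [&& [disjoint x1 & x2]%fset, [disjoint x1 & x3]%fset,
      [disjoint x2 & x3]%fset & x1 `|` x2 `|` x3 == eta].
Proof.
apply/allpairsPdep/and4P => [[a [b [+ + [-> -> ->]]]]|].
  rewrite !fpowersetE => /fsubsetP ae /fsubsetP bea.
  have {}bea x : x \in b -> (x \notin a) && (x \in eta).
    by move=> /bea; rewrite inE.
  split.
  - by apply/fdisjointP => x xa; apply/negP => /bea; rewrite xa.
  - by apply/fdisjointP => x xa; rewrite !inE xa andbF.
  - by apply/fdisjointP => x xb; rewrite !inE xb.
  - apply/eqP/fsetP => x; rewrite !inE.
    have [/ae ->//|xa] := boolP (x \in a).
    by have [/bea/andP[_ ->]//|xb] := boolP (x \in b).
move=> [/fdisjointP d12 /fdisjointP d13 /fdisjointP d23 /eqP <-].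
exists x1, x2; rewrite !fpowersetE; split.
- by apply/fsubsetP => x xx1; rewrite !inE xx1.
- apply/fsubsetP => x xx2; rewrite !inE xx2 orbT /= andbT.
  by apply/negP => /d12; rewrite xx2.
- congr (_, _, _); apply/fsetP => x; rewrite !inE.
  have [xx3|xx3] := boolP (x \in x3); last first.
    by case: (x \in x1); case: (x \in x2).
  have [/d13|_] := boolP (x \in x1); first by rewrite xx3.
  by have [/d23|_] := boolP (x \in x2); first by rewrite xx3.
Qed.

Definition ast_conv (G1 G2 : fconf X -> R) (eta : fconf X) : R :=
  \sum_(xi <- fpowerset eta) G1 xi * G2 (eta `\` xi).

Definition star_conv (G1 G2 : fconf X -> R) (eta : fconf X) : R :=
  \sum_(p <- parts3 eta) let '(xi1, xi2, xi3) := p in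
    G1 (xi1 `|` xi2) * G2 (xi2 `|` xi3).

Definition star2_conv (G1 G2 : fconf X * fconf X -> R)
    (eta : fconf X * fconf X) : R :=
  \sum_(p <- parts3 eta.1) \sum_(q <- parts3 eta.2)
    let '(xi1, xi2, xi3) := p in let '(zeta1, zeta2, zeta3) := q in
    G1 (xi1 `|` xi2, zeta1 `|` zeta2) * G2 (xi2 `|` xi3, zeta2 `|` zeta3).

End convolutions.

(* That the integrals are well defined is read as integrability, and is part of
   positive definiteness. *)
Section positive_definiteness.
Variables (R : realType) (X : ptopologicalType).
Variable m : set (borel X) -> \bar R.
Local Notation lam := (lebesgue_poisson m).

Definition star_positive_definite (k : fconf X -> R) : Prop :=
  measurable_fun setT (k : borel (fconf X) -> R) /\
  forall G, Bbs G ->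
    lam.-integrable setT (fun eta => (star_conv G G eta * k eta)%:E) /\
    (0 <= \int[lam]_eta (star_conv G G eta * k eta)%:E)%E.

(* [lam \x lam] is defined on the product sigma-algebra, which is the Borel
   sigma-algebra of the product space by second countability. *)
Definition star2_positive_definite (k : fconf X * fconf X -> R) : Prop :=
  measurable_fun setT (k : borel (fconf X * fconf X)%type -> R) /\
  forall G, Bbs2 G ->
    (lam \x lam)%E.-integrable setT
      (fun p : borel (fconf X) * borel (fconf X) =>
         (star2_conv G G p * k p)%:E) /\
    (0 <= \int[lam \x lam]_p (star2_conv G G p * k p)%:E)%E.

End positive_definiteness.

(* Main.v *)
From HB Require Import structures.
Require Import Defs.
From mathcomp Require Import all_boot all_order all_algebra finmap.
From mathcomp Require Import all_classical all_reals all_analysis.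
From mathcomp Require Import measurable_realfun.

(** Write [lam] for the Lebesgue-Poisson measure.  The argument transfers a test
    function on configurations to a test function on pairs of configurations.

    Given [G] on finite configurations, let [spread G (a, b)] be [G (a `|` b)]
    when [a] and [b] are disjoint, and [0] otherwise.  If [a] and [b] are
    disjoint, an ordered partition of [a `|` b] into three parts is the same as
    a pair of such partitions of [a] and of [b], so the two-type convolution of
    [spread G] with itself at [(a, b)] is the convolution of [G] with itself at
    [a `|` b] ([star2_conv_spread]).  Summing
    [F (a, b) := star2_conv (spread G) (spread G) (a, b) * (k1 a * k2 b)] over
    all the splittings [eta = xi `|` (eta `\` xi)] therefore gives
    [star_conv G G eta * ast_conv k1 k2 eta] ([sum_fpowerset_spread]).

    The second ingredient is the identity
    [\int lam(d eta) \sum_(xi <= eta) F (xi, eta `\` xi) = \int (lam \x lam) F]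
    for nonnegative [F] ([lebesgue_poisson_convolution]), which extends to
    integrable [F] by splitting it into positive and negative parts
    ([integral_sum_splittings]).  Read on tuples, the left-hand side is a sum
    over [n], with weight [1 / n!], of the integrals over [X^n] of
    [F (mask b t, mask (~ b) t)], where [b] runs through the bit sequences of
    length [n].  By Tonelli each of them equals an integral over [X^j] and
    [X^(n - j)] with [j] the number of true bits of [b] ([integral_pm_mask]),
    and there are ['C(n, j)] such [b], whence the weights [1 / (j! (n - j)!)] of
    [lam \x lam].  Atomlessness of [m] is used to discard the tuples that have
    repeated entries, on which the sum over the subsets of a configuration is
    not a sum over bit sequences.

    With these two facts, positivity for the test function [spread G] is
    positivity for [G].

    What remains is measurability.  Since [X] is Hausdorff and second countable,
    configurations are covered by countably many open sets on which the points
    can be enumerated measurably: those with one point in each of finitely many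
    pairwise disjoint basic open sets.  Hence a function of one or two
    configurations is Borel as soon as it is measurable when composed with the
    maps sending a tuple to the configuration of its entries
    ([measurable_fun_fconf2], [measurable_fun_fconf]). *)

Set Implicit Arguments.
Unset Strict Implicit.
Unset Printing Implicit Defensive.

Import Order.TTheory GRing.Theory Num.Theory.
Local Open Scope classical_set_scope.
Local Open Scope ring_scope.

(** * Borel structure of the configuration space *)

(** [V] enumerates a countable basis of the topology. *)
Definition enum_basis (X : ptopologicalType) (V : nat -> set X) :=
  (forall k, open (V k)) /\
  forall (O : set X) x, open O -> O x -> exists2 k, V k x & V k `<=` O.

Lemma second_countable_enum (X : ptopologicalType) :
  @second_countable X -> exists V : nat -> set X, enum_basis V.
Proof.
move=> [B /countable_injP[f fI] [oB bB]].
pose P k := [set U | B U /\ f U = k].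
exists (fun k => xget setT (P k)); split.
  by move=> k; case: xgetP => [U _ [/oB]|_] //; exact: openT.
move=> O x oO Ox.
have [U [BU Ux] UO] := bB x _ (open_nbhs_nbhs (conj oO Ox)).
suff UE : xget setT (P (f U)) = U by exists (f U); rewrite UE.
case: xgetP => [W _ [BW fW]|/(_ U)[]//].
by apply: fI => //; rewrite inE.
Qed.

Section finite_products.
Variables (X : ptopologicalType) (n : nat).

(** In a finite product, open sets contain a box of open sets around each of
    their points. *)
Lemma nbhs_box (v : prod_topology (fun _ : 'I_n => X)) (W : set _) :
  open W -> W v ->
  exists2 O : 'I_n -> set X, (forall i, open (O i) /\ O i (v i)) &
    forall w : 'I_n -> X, (forall i, O i (w i)) -> W w.
Proof.
move=> oW Wv.
pose F : set_system (prod_topology (fun _ : 'I_n => X)) :=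
  [set A | exists2 O : 'I_n -> set X, (forall i, open (O i) /\ O i (v i)) &
    forall w : 'I_n -> X, (forall i, O i (w i)) -> A w].
(* [F] consists of the sets that contain a box around [v]; it refines the
   neighbourhood filter because it converges to [v] coordinatewise. *)
have FF : Filter F.
  split.
  - by exists (fun=> setT) => // i; split => //; exact: openT.
  - move=> A B [ O OP OA] [ O' OP' OB]; exists (fun i => O i `&` O' i).
      move=> i; have [? ?] := OP i; have [? ?] := OP' i.
      by split; [exact: openI|].
    by move=> w wO; split; [apply: OA|apply: OB] => i; have [] := wO i.
  - by move=> A B AB [ O OP OA]; exists O => // w /OA/AB.
suff Fv : F --> v by apply: Fv; apply: open_nbhs_nbhs.
apply/cvg_sup => i A [B [[ O oO <-] Ov] OA].
exists (fun j => if j == i then O else setT).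
  move=> j; case: eqVneq => [->|_]; split => //; exact: openT.
by move=> w /(_ i); rewrite eqxx => Ow; exact: OA.
Qed.

Lemma open_coordinatewise (O : 'I_n -> set X) : (forall i, open (O i)) ->
  open ([set v | forall i, O i (v i)] : set (prod_topology (fun _ : 'I_n => X))).
Proof.
move=> oO; rewrite openE => v vO.
have : forall i, nbhs v [set w : prod_topology (fun _ : 'I_n => X) | O i (w i)].
  move=> i; apply: (@proj_continuous _ (fun _ : 'I_n => X) i v).
  by apply: open_nbhs_nbhs; split; [exact: oO|exact: vO].
move=> H; have := @filter_forall _ 'I_n
  (fun i => [set w : prod_topology (fun _ : 'I_n => X) | O i (w i)]) (nbhs v) _ H.
exact: (fun h => h (nbhs_filter _)).
Qed.

Variable V : nat -> set X.
Hypothesis bV : enum_basis V.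

Lemma open_tuple_measurable (W : set (prod_topology (fun _ : 'I_n => X))) :
  open W -> measurable [set t : n.-tuple (borel X) | W (tnth t)].
Proof.
move=> oW.
pose box (k : n.-tuple nat) : set (n.-tuple (borel X)) :=
  [set t | forall i, V (tnth k i) (tnth t i)].
pose K : set (n.-tuple nat) :=
  [set k | forall w : 'I_n -> X, (forall i, V (tnth k i) (w i)) -> W w].
rewrite (_ : mkset _ = \bigcup_(k in K) box k); last first.
  apply/seteqP; split => [t Wt|t [k Kk kt]]; last exact: Kk.
  have [ O OP OW] := nbhs_box oW Wt.
  have /choice[k kP] : forall i, exists k, V k (tnth t i) /\ V k `<=` O i.
    by move=> i; have [oO Ot] := OP i; have [k] := bV.2 _ _ oO Ot; exists k.
  exists (mktuple k) => [w wk|i]; last by rewrite tnth_mktuple; case: (kP i).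
  by apply: OW => i; have := wk i; rewrite tnth_mktuple; have [_] := kP i; apply.
rewrite bigcup_mkcond; apply: countable_bigcupT_measurable => [|k].
  exact: countableP.
case: ifP => _ //; rewrite (_ : box k = \bigcap_(i in [set: 'I_n])
    ((@tnth n (borel X))^~ i @^-1` V (tnth k i))); last first.
  apply/seteqP; split => [t bt i _|t bt i]; [exact: bt|exact: (bt i)].
apply: fin_bigcap_measurable => // i _.
rewrite -[X in measurable X]setTI; apply: measurable_tnth => //.
by apply: sub_sigma_algebra; exact: bV.1.
Qed.

End finite_products.

(** Pairwise disjointness of a finite family of sets, stated pointwise. *)
Definition disjoint_sets (X : Type) (n : nat) (U : 'I_n -> set X) :=
  forall i j x, U i x -> U j x -> i = j.

Section separated_configurations.
Variables (X : ptopologicalType) (n : nat).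
Implicit Types U : 'I_n -> set X.

Lemma in_conf_of_tuple (p : nat) (t : p.-tuple X) x :
  (x \in conf_of_tuple t) = (x \in tval t).
Proof. by rewrite inE. Qed.

(** For pairwise disjoint [U i], the configurations with exactly [n] points, one
    in each [U i]. *)
Definition sepconf U : set (fconf X) :=
  [set eta | exists2 t : n.-tuple X, (forall i, U i (tnth t i)) &
     eta = conf_of_tuple t].

Lemma sepconf_open U : (forall i, open (U i)) -> disjoint_sets U ->
  open (sepconf U).
Proof.
move=> oU dU; rewrite -[open _]/(fconf_open (sepconf U)) => p.
pose W (s : 'I_n -> 'I_p) : set (prod_topology (fun _ : 'I_p => X)) :=
  [set v | forall i, U i (v (s i))].
(* A tuple [t] of distinct points enumerates an element of [sepconf U] iff it does
   so along a surjection [s] with [t (s i)] in [U i]. *)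
exists (\bigcup_(s in [set s | forall j, exists i, s i = j]) W s).
  apply: bigcup_open => s ss.
  pose g j := \bigcap_(i in [set i | s i = j]) U i.
  rewrite (_ : W s = [set v | forall j, g j (v j)]).
    apply: open_coordinatewise => j; rewrite openE => x gx.
    have : forall i : 'I_n, nbhs x (if s i == j then U i else setT).
      move=> i; case: eqP => sij; last exact: filterT.
      by apply: open_nbhs_nbhs; split; [exact: oU|exact: gx].
    move=> /(filter_forall (nbhs_filter x)); apply: filterS => y yU i sij.
    by have := yU i; rewrite sij eqxx.
  apply/seteqP; split => [v Wv j i <- //|v gv i].
  exact: (gv (s i) i erefl).
move=> t ut; split.
  move=> [t' Ut' tt'].
  have /choice[s sP] : forall i, exists j, tnth t j = tnth t' i.
    move=> i; have : tnth t' i \in tval t.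
      by rewrite -in_conf_of_tuple tt' in_conf_of_tuple mem_tnth.
    by move=> /tnthP[j ->]; exists j.
  exists s; last by move=> i; rewrite /= sP.
  move=> j; have : tnth t j \in tval t'.
    by rewrite -in_conf_of_tuple -tt' in_conf_of_tuple mem_tnth.
  move=> /tnthP[i tji]; exists i.
  by have /tuple_uniqP := ut; apply; rewrite sP.
move=> [s ss Ws]; exists [tuple tnth t (s i) | i < n].
  by move=> i; rewrite tnth_mktuple; exact: Ws.
apply/fsetP => x; rewrite !in_conf_of_tuple; apply/idP/idP.
  by move=> /tnthP[j ->]; have [i <-] := ss j; apply/mapP; exists i;
    rewrite ?mem_enum.
by move=> /mapP[i _ ->]; rewrite mem_tnth.
Qed.

(** For pairwise disjoint [U], this enumerates the points of a configuration of
    [sepconf U] in the order of the [U i].  Outside [sepconf U] it is constant,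
    so that it is measurable on the whole space. *)
Definition section_of U (eta : fconf X) : n.-tuple X :=
  [tuple if eta \in sepconf U then xget point [set x | x \in eta /\ U i x]
         else point | i < n].

Lemma section_ofE U (t : n.-tuple X) : disjoint_sets U ->
  (forall i, U i (tnth t i)) -> section_of U (conf_of_tuple t) = t.
Proof.
move=> dU Ut; apply: eq_from_tnth => i; rewrite tnth_mktuple ifT; last first.
  by rewrite inE; exists t.
case: xgetP => [x _ [xt Uix]|/(_ (tnth t i))[]]; last first.
  by split; rewrite ?in_conf_of_tuple ?mem_tnth.
move: xt; rewrite in_conf_of_tuple => /tnthP[j xj].
by move: Uix; rewrite xj => Uj; rewrite (dU _ _ _ Uj (Ut j)).
Qed.

Lemma sepconf_uniq U (t : n.-tuple X) : disjoint_sets U ->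
  (forall i, U i (tnth t i)) -> uniq t.
Proof.
move=> dU Ut; apply/tuple_uniqP => i j tij.
by have := Ut j; rewrite -tij; apply: dU.
Qed.

Lemma measurable_section_of U : (forall i, open (U i)) -> disjoint_sets U ->
  measurable_fun setT (section_of U : borel (fconf X) -> n.-tuple (borel X)).
Proof.
move=> oU dU; apply/measurable_fun_tnthP => i.
apply: (@measurability _ _ _ (borel X) _ _ (@open X)) => // _ [B oB <-].
rewrite setTI.
pose U' j := if j == i then U i `&` B else U j.
have sU' j : U' j `<=` U j by rewrite /U'; case: eqVneq => [->|_ //] x [].
have oU' j : open (U' j) by rewrite /U'; case: ifP => _ //; exact: openI.
have dU' : disjoint_sets U' by move=> j k x /sU' Uj /sU' Uk; exact: (dU _ _ x).
have mC : measurable (~` sepconf U : set (borel (fconf X))).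
  by apply: measurableC; apply: sub_sigma_algebra; exact: sepconf_open.
have mO : measurable (sepconf U' : set (borel (fconf X))).
  by apply: sub_sigma_algebra; exact: sepconf_open.
(* Inside [sepconf U] the [i]-th point lies in [B] exactly when the
   configuration is separated by the family where [U i] is cut down to [B]. *)
rewrite (_ : _ @^-1` B = sepconf U' `|`
    (if `[< B point >] then ~` sepconf U else set0)).
  by apply: measurableU => //; case: ifP.
apply/seteqP; split => eta /=.
  have [[t Ut ->]|nU] := pselect (sepconf U eta).
    rewrite section_ofE// => Ot; left; exists t => // j; rewrite /U'.
    by case: eqVneq => [->|_ //]; split.
  rewrite tnth_mktuple ifF; last by apply/negP; rewrite inE.
  by move=> Op; right; rewrite asboolT.
case=> [[t U't ->]|].
  rewrite section_ofE//; last by move=> j; exact: sU'.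
  by have := U't i; rewrite /U' eqxx => -[].
case: asboolP => // Op nU; rewrite tnth_mktuple ifF//.
by apply/negP; rewrite inE.
Qed.

End separated_configurations.

(** The configuration of the entries of a sequence.  Sequences with repetitions
    are sent to the empty configuration, which makes the map measurable on all
    tuples rather than on the distinct ones only. *)
Definition conf_of_seq (X : choiceType) (s : seq X) : fconf X :=
  if uniq s then [fset x | x in s]%fset else fset0.

Section measurable_configurations.
Variable X : ptopologicalType.
Variable V : nat -> set X.
Hypotheses (hX : hausdorff_space X) (bV : enum_basis V).

Lemma conf_of_seqE (n : nat) (t : n.-tuple X) : uniq t ->
  conf_of_seq t = conf_of_tuple t.
Proof. by rewrite /conf_of_seq => ->. Qed.

Lemma separate_points (n : nat) (t : n.-tuple X) : uniq t ->
  exists2 U : 'I_n -> set X, disjoint_sets U &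
    forall i, open (U i) /\ U i (tnth t i).
Proof.
move=> /tuple_uniqP ut.
have /choice[A AP] : forall ij : 'I_n * 'I_n, exists A : set X * set X,
    ij.1 != ij.2 -> [/\ open A.1, open A.2, A.1 (tnth t ij.1),
      A.2 (tnth t ij.2) & A.1 `&` A.2 = set0].
  move=> [i j] /=; have [->|ij] := eqVneq i j; first by exists (set0, set0).
  have tij : tnth t i != tnth t j by apply: contra_neq ij; exact: ut.
  move: hX; rewrite open_hausdorff => /(_ _ _ tij)[A [A1 A2] [oA1 oA2 /eqP A12]].
  by exists A => _; split => //; [move: A1|move: A2]; rewrite inE.
pose U i := [set x | forall j, i != j -> (A (i, j)).1 x /\ (A (j, i)).2 x].
exists U.
  move=> i j x Ux Ux'; apply/eqP; apply: contraT => ij.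
  have [Ai _] := Ux j ij; have ji : j != i by rewrite eq_sym.
  have [_ Aj] := Ux' i ji.
  have [_ _ _ _ A0] := AP (i, j) ij.
  by have : set0 x by rewrite -A0; split.
move=> i; split; last first.
  move=> j ij; have ji : j != i by rewrite eq_sym.
  by have [_ _ ? _ _] := AP (i, j) ij; have [_ _ _ ? _] := AP (j, i) ji.
rewrite openE => x Ux.
have : forall j : 'I_n, nbhs x
    (if i != j then (A (i, j)).1 `&` (A (j, i)).2 else setT).
  move=> j; case: ifPn => [ij|_]; last exact: filterT.
  have ji : j != i by rewrite eq_sym.
  apply: open_nbhs_nbhs; split; last exact: Ux.
  have [oA _ _ _ _] := AP (i, j) ij; have [_ oA' _ _ _] := AP (j, i) ji.
  exact: openI.
move=> /(filter_forall (nbhs_filter x)); apply: filterS => y yU j ij.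
by have := yU j; rewrite ij.
Qed.

Lemma measurable_uniq (n : nat) :
  measurable_fun setT (fun t : n.-tuple (borel X) => uniq t).
Proof.
apply: (measurable_fun_bool true); rewrite setTI.
pose W : set (prod_topology (fun _ : 'I_n => X)) := [set v | injective v].
rewrite (_ : _ @^-1` _ = [set t | W (tnth t)]); last first.
  by apply/seteqP; split => t /tuple_uniqP.
apply: (open_tuple_measurable bV).
rewrite openE => v vI.
have ut : uniq (mktuple v).
  by apply/tuple_uniqP => i j; rewrite !tnth_mktuple; exact: vI.
have [U dU UP] := separate_points ut.
have oU := @open_coordinatewise _ _ U (fun i => (UP i).1).
apply: (filterS _ (open_nbhs_nbhs (conj oU _))).
  by move=> w wU i j wij; apply: (dU _ _ (w i)); [|rewrite wij]; exact: wU.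
by move=> i; have [_] := UP i; rewrite tnth_mktuple.
Qed.

Lemma measurable_conf_of_seq (n : nat) : measurable_fun setT
  (fun t : n.-tuple (borel X) => @conf_of_seq X t : borel (fconf X)).
Proof.
apply: (@measurability _ _ _ (borel (fconf X)) _ _ (@open (fconf X))) => // _ [B oB <-].
rewrite setTI.
have [W oW WB] := (oB : fconf_open B) n.
pose Un := [set t : n.-tuple (borel X) | uniq t].
have mu : measurable Un.
  by have := @measurable_uniq n measurableT [set true] I; rewrite setTI.
rewrite (_ : _ @^-1` _ = (Un `&` [set t | W (tnth t)]) `|`
    (if `[< B fset0 >] then ~` Un else set0)).
  apply: measurableU.
    by apply: measurableI => //; exact: (open_tuple_measurable bV).
  by case: ifP => // _; exact: measurableC.
apply/seteqP; split => t /=; rewrite /conf_of_seq.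
  case: ifPn => ut Bt; first by left; split => //; apply/(WB t ut).
  by right; rewrite asboolT//; exact/negP.
case=> [[ut Wt]|]; first by rewrite ut; apply/(WB _ ut).
by case: asboolP => // B0 /negP/negPf ->.
Qed.

(** Every configuration is separated by a family of basic open sets, and there
    are countably many such families. *)
Lemma sepconf_cover (eta : fconf X) : exists k : {n & n.-tuple nat},
  let U i := V (tnth (tagged k) i) in disjoint_sets U /\ sepconf U eta.
Proof.
have [U dU UP] := separate_points (fset_uniq eta : uniq (in_tuple eta)).
have /choice[k kP] : forall i, exists k,
    V k (tnth (in_tuple eta) i) /\ V k `<=` U i.
  by move=> i; have [oU Ut] := UP i; have [k] := bV.2 _ _ oU Ut; exists k.
exists (Tagged (fun n => n.-tuple nat) (mktuple k)); split => /=.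
  move=> i j x; rewrite !tnth_mktuple => /(kP i).2 Ui /(kP j).2 Uj.
  exact: (dU _ _ x).
exists (in_tuple eta); first by move=> i; rewrite tnth_mktuple; have [] := kP i.
by apply/fsetP => x; rewrite in_conf_of_tuple.
Qed.

(** On [sepconf U1 `*` sepconf U2] the function [f] is its lift to tuples composed
    with the measurable sections, and countably many such sets cover the pairs of
    configurations. *)
Lemma measurable_fun_fconf2 d (T : measurableType d)
    (f : borel (fconf X) * borel (fconf X) -> T) :
  (forall n p, measurable_fun setT
     (fun t : n.-tuple (borel X) * p.-tuple (borel X) =>
        f (@conf_of_seq X t.1, @conf_of_seq X t.2))) ->
  measurable_fun setT f.
Proof.
move=> mf _ B mB; rewrite setTI.
pose I := {n & n.-tuple nat}.
pose U (k : I) i := V (tnth (tagged k) i).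
have oU k i : open (U k i) by exact: bV.1.
pose S (k : I) : set (borel (fconf X)) := sepconf (U k).
pose D (q : I * I) := S q.1 `*` S q.2.
pose K := [set q : I * I | disjoint_sets (U q.1) /\ disjoint_sets (U q.2)].
rewrite (_ : f @^-1` B = \bigcup_(q in K) (D q `&` f @^-1` B)); last first.
  apply/seteqP; split => [[eta1 eta2] fB|p [q _ []//]].
  have [k1 [dk1 Sk1]] := sepconf_cover eta1.
  have [k2 [dk2 Sk2]] := sepconf_cover eta2.
  by exists (k1, k2).
rewrite bigcup_mkcond; apply: countable_bigcupT_measurable => [|[k1 k2]].
  exact: countableP.
case: ifPn => //; rewrite inE => -[/= dk1 dk2].
pose s (p : borel (fconf X) * borel (fconf X)) :
  (tag k1).-tuple (borel X) * (tag k2).-tuple (borel X) :=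
  (section_of (U k1) p.1, section_of (U k2) p.2).
have ms : measurable_fun setT s.
  by apply: measurable_fun_pair; (apply: measurableT_comp => //);
    exact: measurable_section_of.
pose g (t : (tag k1).-tuple (borel X) * (tag k2).-tuple (borel X)) :=
  f (@conf_of_seq X t.1, @conf_of_seq X t.2).
have mg : measurable_fun setT g by exact: mf.
rewrite (_ : _ `&` _ = D (k1, k2) `&` (s @^-1` (g @^-1` B))).
  apply: measurableI.
    by apply: measurableX; apply: sub_sigma_algebra; exact: sepconf_open.
  rewrite -[X in measurable X]setTI; apply: ms => //.
  by rewrite -[X in measurable X]setTI; exact: mg.
have gs p : D (k1, k2) p -> g (s p) = f p.
  case: p => _ _ [/= [t1 Ut1 ->] [t2 Ut2 ->]].
  have -> : s (conf_of_tuple t1, conf_of_tuple t2) = (t1, t2).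
    by rewrite /s (section_ofE dk1 Ut1) (section_ofE dk2 Ut2).
  by rewrite /g !conf_of_seqE//;
    [exact: sepconf_uniq Ut2|exact: sepconf_uniq Ut1].
by apply/seteqP; split => p [Dp fB]; split => //=; move: fB; rewrite /= gs.
Qed.

Lemma measurable_fun_fconf d (T : measurableType d)
    (f : borel (fconf X) -> T) :
  (forall n, measurable_fun setT
     (fun t : n.-tuple (borel X) => f (@conf_of_seq X t))) ->
  measurable_fun setT f.
Proof.
move=> mf.
have : measurable_fun setT (fun p : borel (fconf X) * borel (fconf X) => f p.1).
  apply: measurable_fun_fconf2 => n p /=.
  exact: (measurableT_comp (mf n) measurable_fst).
move=> mf1; exact: (measurableT_comp mf1
  (@pair2_measurable _ _ (borel (fconf X)) (borel (fconf X)) point)).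
Qed.

End measurable_configurations.

(** * Measurable families of sequences *)

(** A measurable family of sequences of constant length [n].  The tuple-valued
    version is existentially quantified so that lengths are only compared up to
    provable equality. *)
Definition measurable_seq d d' (T : measurableType d) (S : measurableType d')
    (n : nat) (g : T -> seq S) :=
  exists2 g' : T -> n.-tuple S, measurable_fun setT g' &
    forall x, g x = g' x.

Section measurable_seq.
Context d d' d'' (T : measurableType d) (S : measurableType d')
  (U : measurableType d'').
Implicit Types (g h : T -> seq S).

Lemma measurable_seq_nil : measurable_seq 0 (fun _ : T => [::] : seq S).
Proof. by exists (fun=> [tuple]). Qed.

Lemma measurable_seq_cons n (f : T -> S) g : measurable_fun setT f ->
  measurable_seq n g -> measurable_seq n.+1 (fun x => f x :: g x).
Proof.
move=> mf [g' mg' gg']; exists (fun x => [tuple of f x :: g' x]).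
  exact: measurable_cons.
by move=> x; rewrite gg'.
Qed.

Lemma measurable_seqS n g : measurable_seq n.+1 g ->
  exists f h, [/\ measurable_fun setT f, measurable_seq n h &
    forall x, g x = f x :: h x].
Proof.
move=> [g' mg' gg']; exists (fun x => thead (g' x)), (fun x => behead (g' x)).
split; last by move=> x; rewrite gg'; case/tupleP: (g' x) => y t; rewrite theadE.
  by move/measurable_fun_tnthP: mg'; apply.
exists (fun x => [tuple of behead (g' x)]) => //.
exact: (measurableT_comp (@measurable_behead _ S n) mg').
Qed.

Lemma measurable_seq_mask n (b : seq bool) g : size b = n ->
  measurable_seq n g -> measurable_seq (count id b) (fun x => mask b (g x)).
Proof.
move=> <- {n}; elim: b g => [|c b IH] g.
  by move=> _; exact: measurable_seq_nil.
move=> /measurable_seqS[f [h [mf /IH mh gE]]].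
rewrite (_ : (fun x => _) = (fun x => mask (c :: b) (f x :: h x))); last first.
  by apply/funext => x; rewrite gE.
by case: c => //=; exact: measurable_seq_cons.
Qed.

Lemma measurable_seq_cat n p g h : measurable_seq n g -> measurable_seq p h ->
  measurable_seq (n + p) (fun x => g x ++ h x).
Proof.
move=> + mh; elim: n g => [|n IH] g.
  move=> [g' _ gg']; rewrite (_ : (fun x => _) = h)//.
  by apply/funext => x; rewrite gg' tuple0.
move=> /measurable_seqS[f [g1 [mf /IH mg gE]]].
rewrite (_ : (fun x => _) = (fun x => f x :: (g1 x ++ h x))).
  exact: measurable_seq_cons.
by apply/funext => x; rewrite gE.
Qed.

Lemma measurable_seq_comp n g (F : seq S -> U) : measurable_seq n g ->
  measurable_fun setT (fun t : n.-tuple S => F t) ->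
  measurable_fun setT (fun x => F (g x)).
Proof.
move=> [g' mg' gg'] mF; rewrite (_ : (fun x => _) = (fun x => F (g' x))).
  exact: (measurableT_comp mF mg').
by apply/funext => x; rewrite gg'.
Qed.

Lemma measurable_seq_comp2 n p g h (F : seq S -> seq S -> U) :
  measurable_seq n g -> measurable_seq p h ->
  measurable_fun setT (fun t : n.-tuple S * p.-tuple S => F t.1 t.2) ->
  measurable_fun setT (fun x => F (g x) (h x)).
Proof.
move=> [g' mg' gg'] [h' mh' hh'] mF.
rewrite (_ : (fun x => _) =
  (fun t : n.-tuple S * p.-tuple S => F t.1 t.2) \o (fun x => (g' x, h' x))).
  by apply: measurableT_comp => //; exact: measurable_fun_pair.
by apply/funext => x; rewrite gg' hh'.
Qed.

End measurable_seq.

Lemma measurable_seq_tuple d d' (T : measurableType d) (S : measurableType d')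
    n (g : T -> n.-tuple S) : measurable_fun setT g ->
  measurable_seq n (fun x => tval (g x)).
Proof. by exists g. Qed.

(** * Powers of the measure on the base space *)

Section power_measures.
Variables (R : realType) (X : ptopologicalType).
Variable m : {sigma_finite_measure set (borel X) -> \bar R}.
Local Open Scope ereal_scope.

Let consp n (p : borel X * n.-tuple (borel X)) := [tuple of p.1 :: p.2].

Let measurable_consp n : measurable_fun setT (@consp n).
Proof. exact: measurable_cons. Qed.

(** The powers of a sigma-finite measure, a priori mere set functions, are
    sigma-finite measures. *)
Lemma power_measure_sigma_finite n :
  exists mu : {sigma_finite_measure set (n.-tuple (borel X)) -> \bar R},
    @power_measure R X m n = mu.
Proof.
elim: n => [|n [mu IH]]; first by exists (@dirac _ _ [tuple] R).
pose nu : {measure set (n.+1.-tuple (borel X)) -> \bar R} :=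
  measure_function_pushforward__canonical__measure_function_Measure
    (m \x mu) (@measurable_consp n).
have /sigma_finiteP[F [FT ndF Foo]] := sigma_finiteT m.
have /sigma_finiteP[G [GT ndG Goo]] := sigma_finiteT mu.
have snu : sigma_finite setT nu.
  exists (fun i => [set t | F i (thead t) /\ G i [tuple of behead t]]).
    apply/esym; rewrite -subTset => t _.
    have : setT (thead t) by []. have : setT [tuple of behead t] by [].
    rewrite FT GT => -[j _ Gj] [i _ Fi]; exists (maxn i j) => //; split.
      by move: Fi; apply/subsetPset/ndF/leq_maxl.
    by move: Gj; apply/subsetPset/ndG/leq_maxr.
  move=> i; have [mF Fi] := Foo i; have [mG Gi] := Goo i; split.
    apply: measurableI; rewrite -[X in measurable X]setTI.
      exact: measurable_tnth.
    exact: measurable_behead.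
  rewrite /nu /= /pushforward (_ : _ @^-1` _ = F i `*` G i).
    by rewrite product_measure1E// lte_mul_pinfty// ge0_fin_numE.
  have bK (p : borel X * n.-tuple (borel X)) : [tuple of behead (consp p)] = p.2.
    by case: p => x t; exact: val_inj.
  by apply/seteqP; split=> -[x t] [? Gt]; split => //;
    move: Gt; rewrite /= ?(bK (x, t)).
pose M := HB.pack_for {sigma_finite_measure set _ -> \bar R} (nu : set _ -> \bar R)
  (Measure.class nu) (Measure_isSigmaFinite.Build _ _ _ nu snu).
by exists M; rewrite /= IH.
Qed.

(** The [n]-th power of [m], as a sigma-finite measure. *)
Definition pm n : {sigma_finite_measure set (n.-tuple (borel X)) -> \bar R} :=
  sval (cid (power_measure_sigma_finite n)).

Lemma pmE n : pm n = @power_measure R X m n :> (set _ -> \bar R).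
Proof. by rewrite /pm; case: cid. Qed.

Lemma integral_pm0 (f : 0.-tuple (borel X) -> \bar R) :
  measurable_fun setT f -> \int[pm 0]_t f t = f [tuple].
Proof. by move=> mf; rewrite pmE /= integral_dirac// diracT mul1e. Qed.

Lemma integral_pmS n (f : n.+1.-tuple (borel X) -> \bar R) :
  measurable_fun setT f -> (forall t, 0 <= f t) ->
  \int[pm n.+1]_t f t = \int[m]_x \int[pm n]_t f [tuple of x :: t].
Proof.
move=> mf f0; rewrite pmE /= -pmE.
rewrite ge0_integral_pushforward//.
rewrite preimage_setT fubini_tonelli1//.
- by apply: measurableT_comp => //; exact: measurable_consp.
- by move=> p; exact: f0.
- exact: measurable_consp.
Qed.

Lemma pmS n (A : set (n.+1.-tuple (borel X))) :
  pm n.+1 A = \int[m]_x pm n [set t : n.-tuple (borel X) | A [tuple of x :: t]].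
Proof.
rewrite pmE /= -pmE /pushforward /product_measure1 /=.
apply: eq_integral => x _; congr (pm n _).
by apply/seteqP; split => t; rewrite /xsection/= inE.
Qed.

Lemma measurable_pm_cons n (A : set (n.+1.-tuple (borel X))) : measurable A ->
  measurable_fun setT (fun x : borel X =>
    pm n [set t : n.-tuple (borel X) | A [tuple of x :: t]]).
Proof.
move=> mA.
have mA' : measurable ((@consp n) @^-1` A).
  by rewrite -[X in measurable X]setTI; exact: measurable_consp.
have := measurable_fun_xsection (pm n) mA'.
congr measurable_fun; apply/funext => x /=; congr (pm n _).
by apply/seteqP; split => t; rewrite /xsection/= inE.
Qed.

Lemma measurable_box n (L : set X) : measurable (L : set (borel X)) ->
  measurable [set t : n.-tuple (borel X) | forall i, L (tnth t i)].
Proof.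
move=> mL.
rewrite (_ : mkset _ = \bigcap_(i in [set: 'I_n])
    ((@tnth n (borel X))^~ i @^-1` L)).
  apply: fin_bigcap_measurable => // i _.
  by rewrite -[X in measurable X]setTI; exact: measurable_tnth.
by apply/seteqP; split => t tL i; [move=> _; exact: tL|exact: (tL i)].
Qed.

Lemma pm_box n (L : set X) : measurable (L : set (borel X)) -> m L < +oo ->
  pm n [set t : n.-tuple (borel X) | forall i, L (tnth t i)] < +oo.
Proof.
move=> mL Loo; elim: n => [|n IH].
  by rewrite pmE/= diracE; case: (_ \in _); rewrite ltry.
rewrite pmE /= -pmE /pushforward.
rewrite (_ : _ @^-1` _ = L `*` [set t : n.-tuple (borel X) | forall i, L (tnth t i)]).
  rewrite product_measure1E//; first by rewrite lte_mul_pinfty// ge0_fin_numE.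
  exact: measurable_box.
apply/seteqP; split => -[x t] /=.
  move=> xt; split; first exact: (xt ord0).
  by move=> i; have := xt (lift ord0 i); rewrite tnthS.
by move=> [Lx Lt] i; case: (unliftP ord0 i) => [j|] ->; rewrite ?tnthS// tnth0.
Qed.

Hypothesis m_atomless : non_atomic m.
Variable V : nat -> set X.
Hypotheses (hX : hausdorff_space X) (bV : enum_basis V).

Lemma measurable_singleton (x : X) : measurable ([set x] : set (borel X)).
Proof.
rewrite -[[set x]]setCK; apply: measurableC; apply: sub_sigma_algebra.
apply: closed_openC; exact: accessible_closed_set1 (hausdorff_accessible hX) x.
Qed.

Lemma measurable_mem n (x : X) :
  measurable [set t : n.-tuple (borel X) | x \in tval t].
Proof.
rewrite (_ : mkset _ = \bigcup_(i in [set: 'I_n])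
    ((@tnth n (borel X))^~ i @^-1` [set x])).
  apply: fin_bigcup_measurable => // i _.
  rewrite -[X in measurable X]setTI; apply: measurable_tnth => //.
  exact: measurable_singleton.
by apply/seteqP; split => t /=; [move=> /tnthP[i ->]; exists i|
  move=> [i _ <-]; exact: mem_tnth].
Qed.

Lemma pm_mem0 n (x : X) : pm n [set t : n.-tuple (borel X) | x \in tval t] = 0.
Proof.
elim: n => [|n IH].
  rewrite (_ : mkset _ = set0) ?measure0//.
  by apply/seteqP; split => t //=; rewrite tuple0.
rewrite pmS (ge0_ae_eq_integral (g := cst 0)) ?integral0//.
  exact: (measurable_pm_cons (@measurable_mem n.+1 x)).
exists [set x]; split; first exact: measurable_singleton.
  exact: m_atomless.
move=> y /= ynx; apply: contrapT => yx; apply: ynx => _.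
rewrite -[RHS]IH; congr (pm n _); apply/seteqP; split => t /=; rewrite inE.
  by move=> /orP[/eqP xy|//]; exfalso; apply: yx.
by move=> ->; rewrite orbT.
Qed.

(** For an atomless measure, almost all tuples have distinct entries. *)
Lemma pm_nuniq0 n : pm n [set t : n.-tuple (borel X) | ~~ uniq t] = 0.
Proof.
have mnu p : measurable [set t : p.-tuple (borel X) | ~~ uniq t].
  have := @measurable_uniq _ _ hX bV p measurableT [set false] I.
  rewrite setTI; congr measurable; apply/seteqP; split => t /=.
    by move=> ->.
  by move=> /negPf ->.
elim: n => [|n IH].
  rewrite (_ : mkset _ = set0) ?measure0//.
  by apply/seteqP; split => t //=; rewrite tuple0.
rewrite pmS integral0_eq// => x _.
apply/eqP; rewrite eq_le measure_ge0 andbT.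
have mx := @measurable_mem n x.
rewrite -[leRHS](adde0 0) -{1}(pm_mem0 n x) -IH.
rewrite (_ : mkset _ = [set t : n.-tuple (borel X) | x \in tval t] `|`
  [set t : n.-tuple (borel X) | ~~ uniq t]);
    first by apply: measureU2; [exact: mx|exact: mnu].
by apply/seteqP; split => t /=; rewrite negb_and negbK => /orP.
Qed.

End power_measures.

(** * Splitting an integral over tuples along a bit sequence *)

Lemma measurable_fun_tuple0 d d' (S : measurableType d) (U : measurableType d')
    (f : 0.-tuple S -> U) : measurable_fun setT f.
Proof.
rewrite (_ : f = cst (f [tuple])); first exact: measurable_cst.
by apply/funext => t; rewrite tuple0.
Qed.

Section splitting.
Variables (R : realType) (X : ptopologicalType).
Variable m : {sigma_finite_measure set (borel X) -> \bar R}.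
Local Open Scope ereal_scope.
Local Notation pm := (pm m).
Implicit Types Phi : seq X -> seq X -> \bar R.

(** Functions of two sequences that are measurable on pairs of tuples of any
    two lengths. *)
Definition measurable_seq2 Phi := forall j k, measurable_fun setT
  (fun p : j.-tuple (borel X) * k.-tuple (borel X) => Phi p.1 p.2).

(** Integrating out the second sequence, to which a head may have been added,
    preserves measurability.  The bit [b] tells whether the head [h x] is there. *)
Lemma measurable_integral_seq2 d (T : measurableType d) Phi j k
    (g : T -> seq (borel X)) (h : T -> borel X) (b : bool) :
  measurable_seq2 Phi -> (forall s t, 0 <= Phi s t) ->
  measurable_fun setT h -> measurable_seq j g ->
  measurable_fun setT (fun x => \int[pm k]_t
    Phi (g x) (if b then h x :: (t : seq X) else t)).
Proof.
move=> mPhi Phi0 mh mg.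
pose f (p : T * k.-tuple (borel X)) :=
  Phi (g p.1) (if b then h p.1 :: (p.2 : seq X) else p.2).
apply: (measurable_fun_fubini_tonelli_F (m2 := pm k) f); last by move=> x; exact: Phi0.
have mg1 : measurable_seq j (fun p : T * k.-tuple (borel X) => g p.1).
  have [g' mg' gg'] := mg; exists (fun p => g' p.1) => //.
  exact: (measurableT_comp mg' measurable_fst).
have m2 : measurable_seq k (fun p : T * k.-tuple (borel X) => tval p.2).
  exact: measurable_seq_tuple measurable_snd.
have mc : measurable_seq (b + k) (fun p : T * k.-tuple (borel X) =>
    if b then h p.1 :: (p.2 : seq (borel X)) else p.2).
  case: (b) => //; apply: measurable_seq_cons => //.
  exact: (measurableT_comp mh measurable_fst).
exact: (measurable_seq_comp2 mg1 mc (mPhi j (b + k)%N)).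
Qed.

Lemma measurable_mask (b : seq bool) n : size b = n ->
  measurable_seq (count id b) (fun t : n.-tuple (borel X) =>
    mask b t : seq (borel X)).
Proof.
move=> bn; apply: (measurable_seq_mask bn); apply: measurable_seq_tuple.
exact: measurable_id.
Qed.

Lemma measurable_mask2 (b : seq bool) n Phi : size b = n ->
  measurable_seq2 Phi -> measurable_fun setT (fun t : n.-tuple (borel X) =>
    Phi (mask b t) (mask (map negb b) t)).
Proof.
move=> bn mPhi; have bn' : size (map negb b) = n by rewrite size_map.
exact: (measurable_seq_comp2 (measurable_mask bn) (measurable_mask bn')
  (mPhi _ _)).
Qed.

(** The entries of a tuple selected by [b] and those left out can be integrated
    separately: by induction on [b], the first coordinate is moved to the front
    of one of the two subsequences, with an exchange of integrals when the bit is
    [false]. *)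
Lemma integral_pm_mask (b : seq bool) Phi :
  measurable_seq2 Phi -> (forall s t, 0 <= Phi s t) ->
  \int[pm (size b)]_t Phi (mask b t) (mask (map negb b) t) =
  \int[pm (count id b)]_s \int[pm (count id (map negb b))]_t Phi s t.
Proof.
elim: b Phi => [|c b IH] Phi mPhi Phi0.
  by rewrite !integral_pm0//; exact: measurable_fun_tuple0.
have measurable_seq2_cons (c' : bool) (x : X) : measurable_seq2 (fun s t =>
    Phi (if c' then x :: s else s) (if c' then t else x :: t)).
  move=> j k.
  have mf : measurable_seq j (fun p : j.-tuple (borel X) * k.-tuple (borel X) =>
     tval p.1) by exact: measurable_seq_tuple measurable_fst.
  have ms : measurable_seq k (fun p : j.-tuple (borel X) * k.-tuple (borel X) =>
     tval p.2) by exact: measurable_seq_tuple measurable_snd.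
  have mx : measurable_fun setT
      (fun _ : j.-tuple (borel X) * k.-tuple (borel X) => x : borel X).
    exact: measurable_cst.
  case: c'.
    exact: (measurable_seq_comp2 (measurable_seq_cons mx mf) ms (mPhi j.+1 k)).
  exact: (measurable_seq_comp2 mf (measurable_seq_cons mx ms) (mPhi j k.+1)).
set f := fun t : (size b).+1.-tuple (borel X) =>
  Phi (mask (c :: b) t) (mask (map negb (c :: b)) t).
rewrite [LHS](@integral_pmS _ _ _ _ f); last 2 first.
- exact: (@measurable_mask2 (c :: b)).
- by move=> t; exact: Phi0.
case: c @f => f.
- transitivity (\int[m]_x \int[pm (count id b)]_s
     \int[pm (count id (map negb b))]_t Phi (x :: s) t).
    apply: eq_integral => x _; apply: (IH (fun s => Phi (x :: s))) => //.
    exact: (measurable_seq2_cons true).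
  rewrite [RHS]integral_pmS//; last by move=> t; exact: integral_ge0.
  have mtv := measurable_seq_tuple
    (@measurable_id _ ((count id b).+1.-tuple (borel X)) setT).
  exact: (measurable_integral_seq2 (count id (map negb b)) false mPhi Phi0
    (measurable_cst point) mtv).
- transitivity (\int[m]_x \int[pm (count id b)]_s
     \int[pm (count id (map negb b))]_t Phi s (x :: t)).
    apply: eq_integral => x _; apply: (IH (fun s t => Phi s (x :: t))) => //.
    exact: (measurable_seq2_cons false).
  rewrite (fubini_tonelli (fun p : borel X * (count id b).-tuple (borel X) =>
    \int[pm (count id (map negb b))]_t Phi p.2 (p.1 :: t)))//; last 2 first.
  + exact: (measurable_integral_seq2 _ true mPhi Phi0 measurable_fst
      (measurable_seq_tuple measurable_snd)).
  + by move=> p; exact: integral_ge0.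
  apply: eq_integral => s _.
  rewrite [RHS]integral_pmS//.
  exact: (measurableT_comp (mPhi _ (count id (map negb b)).+1)
    (@pair1_measurable _ _ _ _ s)).
Qed.

End splitting.

(** * Counting the splittings of a tuple *)

Lemma card_count_tuple n k :
  #|[set b : n.-tuple bool | count id b == k]%SET| = 'C(n, k).
Proof.
rewrite -[in RHS](card_ord n) -card_draws.
pose f (A : {set 'I_n}) := [tuple i \in A | i < n].
have fI : injective f.
  move=> A B /(congr1 (@tnth _ _)) AB; apply/setP => i.
  by have := congr1 (fun g => g i) AB; rewrite !tnth_mktuple.
rewrite -(card_imset _ fI); apply: eq_card => b; rewrite !inE.
have cE A : count id (f A) = #|A|.
  rewrite cardE -size_filter /= filter_map size_map; apply/perm_size/uniq_perm.
  - by rewrite filter_uniq// enum_uniq.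
  - exact: enum_uniq.
  - by move=> i; rewrite mem_filter !mem_enum inE andbT.
apply/idP/imsetP => [/eqP <-|[A]]; last by rewrite inE => /eqP <- ->; rewrite cE.
exists [set i | tnth b i]%SET.
  rewrite inE -cE; apply/eqP; congr count; congr tval.
  by apply: eq_from_tnth => i; rewrite tnth_mktuple inE.
by apply: eq_from_tnth => i; rewrite tnth_mktuple inE.
Qed.

Lemma count_negb_tuple n (b : n.-tuple bool) :
  count id (map negb b) = (n - count id b)%N.
Proof.
rewrite count_map -[X in (X - _)%N](size_tuple b) -(count_predC id b) addKn.
exact: eq_count.
Qed.

Section splitting_sums.
Local Open Scope ereal_scope.

Lemma sum_tuple_count (V : nmodType) n (c : nat -> nat -> V) :
  (\sum_(b : n.-tuple bool) c (count id b) (count id (map negb b)) =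
   \sum_(j < n.+1) c j (n - j)%N *+ 'C(n, j))%R.
Proof.
have cn (b : n.-tuple bool) : (count id b < n.+1)%N.
  by rewrite ltnS -[leqRHS](size_tuple b) count_size.
rewrite (partition_big (fun b => Ordinal (cn b)) xpredT)//=.
apply: eq_bigr => j _; rewrite -card_count_tuple -sumr_const.
apply: eq_big => [b|b /eqP <-]; first by rewrite inE.
by rewrite count_negb_tuple.
Qed.

(** Summation of a nonnegative double series along its antidiagonals. *)
Lemma nneseries_cauchy (R : realType) (c : nat -> nat -> \bar R) :
  (forall j k, 0 <= c j k) ->
  \sum_(0 <= n <oo) \sum_(j < n.+1) c j (n - j)%N =
  \sum_(0 <= j <oo) \sum_(0 <= k <oo) c j k.
Proof.
move=> c0.
transitivity (\sum_(0 <= j <oo) \sum_(0 <= n <oo)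
    if (j <= n)%N then c j (n - j)%N else 0); last first.
  apply: eq_eseriesr => j _.
  transitivity (\sum_(j <= n <oo) c j (n - j)%N).
    by rewrite [RHS]eseries_cond -eseries_mkcond.
  rewrite -nneseries_addn//; apply: eq_eseriesr => k _; by rewrite addnK.
rewrite nneseries_interchange; last by move=> i j; case: ifP.
apply: eq_eseriesr => n _.
rewrite (nneseries_split 0 n.+1); last by move=> k _; case: ifP.
rewrite eseries0 ?adde0; last first.
  by move=> i ni _; case: leqP => // H; move: ni; rewrite add0n ltnNge H.
rewrite big_mkord; apply: eq_bigr => j _.
by rewrite -ltnS ltn_ord.
Qed.

(** The ['C(n, j)] bit sequences with [j] true bits turn the weight [1 / n!]
    into [1 / (j! (n - j)!)]. *)
Lemma sum_fact_tuple (R : realType) n (J : nat -> nat -> \bar R) :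
  (forall j k, 0 <= J j k) ->
  (n`!%:R^-1)%:E * \sum_(b : n.-tuple bool)
    J (count id b) (count id (map negb b)) =
  \sum_(j < n.+1) (j`!%:R^-1)%:E * ((n - j)`!%:R^-1)%:E * J j (n - j)%N.
Proof.
move=> J0; rewrite sum_tuple_count ge0_sume_distrr; last first.
  by move=> j _; elim: ('C(n, j)) => //= k IH; rewrite mulrS adde_ge0.
apply: eq_bigr => j _.
have jn : (j <= n)%N by rewrite -ltnS.
rewrite (_ : (_ *+ _)%R = ('C(n, j)%:R)%:E * J j (n - j)%N); last first.
  elim: ('C(n, j)) => [|k IH]; first by rewrite mulr0n mul0e.
  by rewrite mulrS IH -natr1 EFinD ge0_muleDl ?lee_fin// mul1e addeC.
rewrite muleA -!EFinM; congr (_%:E * _).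
rewrite -(bin_fact jn) !natrM !invfM mulrC !mulrA divff ?mul1r//.
by rewrite pnatr_eq0 -lt0n bin_gt0.
Qed.

End splitting_sums.

Section fpowerset_mask.
Variables (X : choiceType).

(** The subsets of the configuration of a tuple with distinct entries correspond
    to the bit sequences of the same length. *)
Lemma fpowerset_mask (n : nat) (t : n.-tuple X) : uniq t ->
  perm_eq [seq conf_of_seq (mask b t) | b : n.-tuple bool]
    (fpowerset (conf_of_seq t)).
Proof.
move=> ut; apply: uniq_perm; last 2 first.
- exact: fset_uniq.
- move=> xi; rewrite fpowersetE; apply/mapP/fsubsetP.
    move=> [b _ ->] x; rewrite /conf_of_seq mask_uniq// ut !inE; exact: mem_mask.
  move=> xit; exists [tuple of map (mem xi) t]; first by rewrite mem_enum.
  rewrite -filter_mask /conf_of_seq filter_uniq//; apply/fsetP => x.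
  rewrite !inE mem_filter /=; apply/idP/andP => [xxi|[]//]; split => //.
  by have := xit _ xxi; rewrite /conf_of_seq ut inE.
rewrite map_inj_uniq ?enum_uniq// => b b' /fsetP bb'; apply: val_inj.
have sb (c : n.-tuple bool) : size c = size t by rewrite !size_tuple.
have mE (c : n.-tuple bool) : tval c = [seq x \in mask c t | x <- t].
  apply: (@eq_from_nth _ false); first by rewrite size_map sb.
  move=> i ic; have it : (i < size t)%N by rewrite -(sb c).
  have x0 : X by move: it; case: (tval t).
  by rewrite (nth_map x0)// in_mask// mem_nth// index_uniq.
rewrite /= (mE b) (mE b'); apply: eq_map => x; have := bb' x.
by rewrite /conf_of_seq !mask_uniq// !inE.
Qed.

Lemma conf_of_seq_maskC (n : nat) (t : n.-tuple X) (b : n.-tuple bool) : uniq t ->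
  conf_of_seq (mask (map negb b) t) =
    (conf_of_seq t `\` conf_of_seq (mask b t))%fset.
Proof.
move=> ut; apply/fsetP => x; rewrite /conf_of_seq !mask_uniq// ut !inE.
rewrite !in_mask// andbC negb_and.
have [xt|_] := boolP (x \in tval t); last by rewrite andbF.
rewrite !andbT (nth_map false)//.
by rewrite size_tuple -[ltnRHS](size_tuple t) index_mem.
Qed.

Lemma sum_fpowerset_mask (V : nmodType) (F : fconf X -> fconf X -> V) (n : nat)
    (t : n.-tuple X) : uniq t ->
  (\sum_(xi <- fpowerset (conf_of_seq t)) F xi (conf_of_seq t `\` xi)%fset =
   \sum_(b : n.-tuple bool)
     F (conf_of_seq (mask b t)) (conf_of_seq (mask (map negb b) t)))%R.
Proof.
move=> ut; rewrite -(perm_big _ (fpowerset_mask ut)) big_image /=.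
by apply: eq_bigr => b _; rewrite conf_of_seq_maskC.
Qed.

End fpowerset_mask.

(** * The Lebesgue-Poisson measure *)

Section lebesgue_poisson_measure.
Variables (R : realType) (X : ptopologicalType).
Variable m : {sigma_finite_measure set (borel X) -> \bar R}.
Hypothesis m_atomless : non_atomic m.
Variable V : nat -> set X.
Hypotheses (hX : hausdorff_space X) (bV : enum_basis V).
Local Open Scope ereal_scope.
Local Notation pm := (pm m).
Local Notation conf := (borel (fconf X)).

Let uniq_tuples n := [set t : n.-tuple (borel X) | uniq t].

Arguments uniq_tuples : clear implicits.

Let measurable_uniq_tuples n : measurable (uniq_tuples n).
Proof.
by have := @measurable_uniq _ _ hX bV n measurableT [set true] I; rewrite setTI.
Qed.

Let conf_seq n (t : n.-tuple (borel X)) : conf := @conf_of_seq X t.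

Let measurable_conf_seq n : measurable_fun setT (@conf_seq n).
Proof. exact: (measurable_conf_of_seq hX bV). Qed.

(* Restricting to the distinct tuples makes this measure equal to [conf_measure]
   on all sets, including the non-measurable ones. *)
Let conf_layer n : {measure set conf -> \bar R} :=
  measure_function_pushforward__canonical__measure_function_Measure
    (measure_function_mrestr__canonical__measure_function_Measure
       (pm n) (@measurable_uniq_tuples n))
    (@measurable_conf_seq n).

Let inv_fact_ge0 n : (0 <= (n`!%:R^-1 : R))%R.
Proof. by rewrite invr_ge0. Qed.

Let lp : {measure set conf -> \bar R} :=
  mseries (fun n => mscale (NngNum (inv_fact_ge0 n)) (conf_layer n)) 0.

Lemma conf_measureE n (A : set conf) : conf_measure m n A = conf_layer n A.
Proof.
rewrite /conf_measure -pmE /= /pushforward /mrestr; congr (pm n _).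
apply/seteqP; split => t [] /=.
  by move=> ut At; split => //; rewrite /conf_seq conf_of_seqE.
by rewrite /conf_seq => At ut; rewrite conf_of_seqE in At.
Qed.

Let lebesgue_poissonE : lebesgue_poisson m = lp.
Proof.
apply/funext => A; apply: eq_eseriesr => n _.
by rewrite conf_measureE.
Qed.

Lemma conf_upto_seq (L : set X) N n (t : n.-tuple (borel X)) : uniq t ->
  conf_upto L N (@conf_of_seq X t) <->
  (forall i, L (tnth t i)) /\ (n <= N)%N.
Proof.
move=> ut; rewrite /conf_upto /= conf_of_seqE// /conf_of_tuple card_fseq.
rewrite undup_id// size_tuple; split => -[Lt ->]; split => //.
  by move=> i; apply: Lt; rewrite /= inE mem_tnth.
by move=> x; rewrite /= inE => /tnthP[i ->].
Qed.

Lemma measurable_conf_upto (L : set X) N : measurable (L : set (borel X)) ->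
  measurable (conf_upto L N : set conf).
Proof.
move=> mL.
suff mf : measurable_fun setT (fun eta : conf => `[< conf_upto L N eta >]).
  have := mf measurableT [set true] I; rewrite setTI; congr measurable.
  by apply/seteqP; split => eta /=; [move/asboolP|move/asboolT].
apply: (measurable_fun_fconf hX bV) => n.
apply: (measurable_fun_bool true); rewrite setTI.
have mU := @measurable_uniq_tuples n.
rewrite (_ : _ @^-1` _ =
  (uniq_tuples n `&` (if (n <= N)%N then
    [set t : n.-tuple (borel X) | forall i, L (tnth t i)] else set0)) `|`
  ~` uniq_tuples n).
  apply: measurableU; last exact: measurableC.
  by apply: measurableI => //; case: ifP => // _; exact: measurable_box.
apply/seteqP; split => t /=.
  have [ut|nut] := boolP (uniq t); last by move=> _; right; exact/negP.
  by move=> /asboolP/(conf_upto_seq _ _ ut)[Lt ->]; left.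
have [ut|nut _] := boolP (uniq t).
  case=> [[_]|/(_ ut)//]; case: ifP => // nN Lt.
  by apply/asboolP/(conf_upto_seq _ _ ut).
apply/asboolP; rewrite /conf_of_seq (negPf nut).
by split => [x /=|]; rewrite ?inE ?cardfs0.
Qed.

Lemma lebesgue_poisson_sigma_finite : sigma_finite setT lp.
Proof.
have /sigma_finiteP[F [FT ndF Foo]] := sigma_finiteT m.
(* Configurations with at most [i] points, all in a set of finite measure, have
   finite Lebesgue-Poisson measure: only the layers up to [i] contribute. *)
exists (fun i => conf_upto (F i) i).
  apply/esym; rewrite -subTset => eta _.
  have /choice[g gP] : forall x, exists i, F i x.
    by move=> x; have : setT x by []; rewrite FT => -[i _ Fi]; exists i.
  exists (maxn #|` eta| (\max_(x <- eta) g x)) => //; split; last exact: leq_maxl.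
  move=> x /= xeta; have : F (g x) x by [].
  apply/subsetPset/ndF/(leq_trans _ (leq_maxr _ _)).
  exact: leq_bigmax_seq.
move=> i; have [mF Fi] := Foo i; split; first exact: measurable_conf_upto.
rewrite /lp /= /mseries (nneseries_split 0 i.+1)// eseries0 ?adde0; last first.
  move=> n ni _.
  transitivity ((n`!%:R^-1)%:E * conf_layer n (conf_upto (F i) i)) => //.
  rewrite /= /pushforward /mrestr (_ : _ `&` _ = set0) ?measure0 ?mule0//.
  apply/seteqP; split => t //= [/[swap] ut /(conf_upto_seq _ _ ut)[_]].
  by rewrite leqNgt ni.
rewrite big_mkord; apply: lte_sum_pinfty => n _.
suff : (n`!%:R^-1)%:E * conf_layer n (conf_upto (F i) i) < +oo by [].
rewrite lte_mul_pinfty ?lee_fin//= /pushforward /mrestr.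
apply: le_lt_trans (pm_box n mF Fi).
apply: le_measure; rewrite ?inE.
- apply: measurableI; last exact: measurable_uniq_tuples.
  rewrite -[X in measurable X]setTI; apply: measurable_conf_seq => //.
  exact: measurable_conf_upto.
- exact: measurable_box.
- by move=> t [/[swap] ut /(conf_upto_seq _ _ ut)[]].
Qed.

(** The Lebesgue-Poisson set function is a sigma-finite measure, and its integral
    is a weighted sum of integrals over tuples.  Repeated entries need not be
    excluded from the latter, as they form null sets. *)
Lemma lebesgue_poisson_measure :
  exists2 mu : {sigma_finite_measure set conf -> \bar R},
    lebesgue_poisson m = mu &
    forall f : conf -> \bar R, measurable_fun setT f -> (forall x, 0 <= f x) ->
      \int[mu]_x f x =
      \sum_(0 <= n <oo) (n`!%:R^-1)%:E * \int[pm n]_t f (@conf_of_seq X t).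
Proof.
pose mu := HB.pack_for {sigma_finite_measure set _ -> \bar R} (lp : set _ -> \bar R)
  (Measure.class lp)
  (Measure_isSigmaFinite.Build _ _ _ lp lebesgue_poisson_sigma_finite).
exists mu; first exact: lebesgue_poissonE.
move=> f mf f0.
rewrite [LHS]ge0_integral_measure_series//; apply: eq_eseriesr => n _.
rewrite ge0_integral_mscale//=; congr (_ * _).
rewrite (ge0_integral_pushforward (@measurable_conf_seq n))// preimage_setT.
apply: (eq_measure_integral (pm n)) => A mA _ /=.
rewrite /mrestr; apply/esym.
have mU := @measurable_uniq_tuples n.
rewrite -[in LHS](setIT A) -(setUv (uniq_tuples n)) setIUr measureU0//.
- exact: measurableI.
- by apply: measurableI => //; exact: measurableC.
apply/eqP; rewrite eq_le measure_ge0 andbT.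
rewrite -[leRHS](pm_nuniq0 m_atomless hX bV n); apply: le_measure; rewrite ?inE.
- by apply: measurableI => //; exact: measurableC.
- rewrite (_ : mkset _ = ~` uniq_tuples n); first exact: measurableC.
  by apply/seteqP; split => t /negP.
- by move=> t [_ /negP].
Qed.

Lemma measurable_seq2_conf (F : conf * conf -> \bar R) :
  measurable_fun setT F ->
  measurable_seq2 (fun s t : seq X => F (conf_of_seq s, conf_of_seq t)).
Proof.
move=> mF j k; apply: (measurableT_comp mF); apply: measurable_fun_pair.
  exact: (measurableT_comp (@measurable_conf_seq j) measurable_fst).
exact: (measurableT_comp (@measurable_conf_seq k) measurable_snd).
Qed.

Lemma measurable_sum_fpowerset (F : conf * conf -> \bar R) :
  measurable_fun setT F ->
  measurable_fun setT (fun eta : conf =>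
    (\sum_(xi <- fpowerset (eta : fconf X)) F (xi, (eta `\` xi)%fset))%R).
Proof.
move=> mF; apply: (measurable_fun_fconf hX bV) => n.
have mPhi := measurable_seq2_conf mF.
rewrite (_ : (fun _ => _) = (fun t : n.-tuple (borel X) => if uniq t then
    (\sum_(b : n.-tuple bool) F (conf_of_seq (mask b t : seq X),
       conf_of_seq (mask (map negb b) t : seq X)))%R
    else (\sum_(xi <- fpowerset (fset0 : fconf X)) F (xi, fset0 `\` xi)%fset)%R)).
  apply: measurable_fun_ifT; last exact: measurable_cst.
    exact: (measurable_uniq hX bV).
  by apply: emeasurable_sum => b; exact: (measurable_mask2 (size_tuple b) mPhi).
apply/funext => t; case: ifPn => [ut|nut].
  exact: (sum_fpowerset_mask (fun a b => F (a, b)) ut).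
by rewrite /conf_of_seq (negPf nut).
Qed.

(** The sum over the splittings of a configuration turns the Lebesgue-Poisson
    measure into its square. *)
Lemma lebesgue_poisson_convolution
    (F : borel (fconf X) * borel (fconf X) -> \bar R) :
  measurable_fun setT F -> (forall p, 0 <= F p) ->
  \int[lebesgue_poisson m]_eta
     (\sum_(xi <- fpowerset (eta : fconf X)) F (xi, (eta `\` xi)%fset))%R =
  \int[(lebesgue_poisson m \x lebesgue_poisson m)]_p F p.
Proof.
move=> mF F0.
have [mu -> muE] := lebesgue_poisson_measure.
pose Phi (s t : seq X) := F (conf_of_seq s, conf_of_seq t).
have mPhi : measurable_seq2 Phi := measurable_seq2_conf mF.
have Phi0 s t : 0 <= Phi s t by exact: F0.
pose J j k := \int[pm j]_s \int[pm k]_t Phi s t.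
have J0 j k : 0 <= J j k by do 2![apply: integral_ge0 => ? _].
have measurable_inner j k : measurable_fun setT
    (fun s : j.-tuple (borel X) => \int[pm k]_t Phi s t).
  apply: (measurable_fun_fubini_tonelli_F (m2 := pm k)
    (fun p : j.-tuple (borel X) * k.-tuple (borel X) => Phi p.1 p.2)).
    exact: mPhi.
  by move=> p; exact: Phi0.
rewrite fubini_tonelli1//.
transitivity (\sum_(0 <= j <oo) \sum_(0 <= k <oo)
    (j`!%:R^-1)%:E * (k`!%:R^-1)%:E * J j k).
  rewrite -nneseries_cauchy; last first.
    by move=> j k; rewrite !mule_ge0// lee_fin.
  rewrite muE; last 2 first.
  - exact: measurable_sum_fpowerset.
  - by move=> eta; apply: sume_ge0.
  apply: eq_eseriesr => n _.
  rewrite -sum_fact_tuple//; congr (_ * _).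
  transitivity (\int[pm n]_t (\sum_(b : n.-tuple bool)
     Phi (mask b t) (mask (map negb b) t))%R).
    apply: ge0_ae_eq_integral => //.
    - exact: (measurableT_comp (measurable_sum_fpowerset mF)
        (@measurable_conf_seq n)).
    - by apply: emeasurable_sum => b; exact: (measurable_mask2 (size_tuple b) mPhi).
    - by move=> t _; exact: sume_ge0.
    - by move=> t _; exact: sume_ge0.
    exists [set t : n.-tuple (borel X) | ~~ uniq t]; split.
    - have := @measurable_uniq _ _ hX bV n measurableT [set false] I.
      rewrite setTI; congr measurable.
      by apply/seteqP; split => t /= /negPf ->.
    - exact: (pm_nuniq0 m_atomless hX bV n).
    move=> t /=; apply: contra_notP => /negP; rewrite negbK => ut _.
    exact: (sum_fpowerset_mask (fun a b => F (a, b)) ut).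
  rewrite ge0_integral_sum//; last first.
    by move=> b; exact: (measurable_mask2 (size_tuple b) mPhi).
  apply: eq_bigr => b _.
  have := integral_pm_mask m b mPhi Phi0; rewrite size_tuple.
  by move->.
rewrite muE; last 2 first.
- exact: (measurable_fun_fubini_tonelli_F (m2 := mu)).
- by move=> x; exact: integral_ge0.
apply: eq_eseriesr => j _.
rewrite (eq_eseriesr
  (g := fun k => (j`!%:R^-1)%:E * ((k`!%:R^-1)%:E * J j k))); last first.
  by move=> k _; rewrite muleA.
rewrite nneseriesZl; last by move=> k _; rewrite mule_ge0// lee_fin.
congr (_ * _).
rewrite /fubini_F.
transitivity (\int[pm j]_s (\sum_(0 <= k <oo) (k`!%:R^-1)%:E *
    \int[pm k]_t Phi s t)).
  rewrite integral_nneseries//.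
  - apply: eq_eseriesr => k _; rewrite ge0_integralZl ?lee_fin//.
      exact: measurable_inner.
    by move=> s _; exact: integral_ge0.
  - by move=> k; apply: measurable_funeM; exact: measurable_inner.
  - by move=> k s _; rewrite mule_ge0 ?lee_fin//; exact: integral_ge0.
apply: eq_integral => s _.
rewrite muE//.
exact: (measurableT_comp mF (@pair1_measurable _ _ _ _ _)).
Qed.

End lebesgue_poisson_measure.

(** * Test functions on pairs of configurations *)

Section spread.
Variables (R : realType) (X : choiceType).
Implicit Types (G : fconf X -> R) (a b : fconf X).
Local Open Scope fset_scope.

(** The function on pairs of configurations induced by [G] through the union.
    Non-disjoint pairs, for which the union loses multiplicities, are sent to 0. *)
Definition spread G (p : fconf X * fconf X) : R :=
  if [disjoint p.1 & p.2]%fset then G (p.1 `|` p.2) else 0.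

Lemma parts3_pointwise a x1 x2 x3 :
  (x1, x2, x3) \in parts3 a <->
  forall x, [/\ (x \in a) = [|| x \in x1, x \in x2 | x \in x3],
    ~~ ((x \in x1) && (x \in x2)), ~~ ((x \in x1) && (x \in x3)) &
    ~~ ((x \in x2) && (x \in x3))].
Proof.
have dP (u v : fconf X) : reflect (forall x, ~~ ((x \in u) && (x \in v)))
    [disjoint u & v]%fset.
  apply: (equivP (@fdisjointP X u v)); split=> uv x.
    by apply/negP => /andP[/uv/negP].
  by move=> xu; have := uv x; rewrite xu.
rewrite parts3P; split.
  move=> /and4P[/dP d12 /dP d13 /dP d23 /eqP <-] x; split => //.
  by rewrite !inE orbA.
move=> h; apply/and4P; split; try by apply/dP => x; case: (h x).
by apply/eqP/fsetP => x; rewrite !inE; case: (h x) => -> _ _ _; rewrite orbA.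
Qed.

Lemma parts3_sub a x1 x2 x3 : (x1, x2, x3) \in parts3 a ->
  [/\ x1 `<=` a, x2 `<=` a & x3 `<=` a].
Proof.
by move=> /parts3_pointwise h; split; apply/fsubsetP => x xi;
  case: (h x) => ->; rewrite xi ?orbT.
Qed.

(* Partitions of two disjoint sets are glued part by part. *)
Let join3 (p q : fconf X * fconf X * fconf X) : fconf X * fconf X * fconf X :=
  (p.1.1 `|` q.1.1, p.1.2 `|` q.1.2, p.2 `|` q.2).

Lemma parts3_fsetU a b : [disjoint a & b]%fset ->
  perm_eq (parts3 (a `|` b)) [seq join3 p q | p <- parts3 a, q <- parts3 b].
Proof.
move=> /fdisjointP dab.
have {}dab x : ~~ ((x \in a) && (x \in b)).
  by apply/negP => /andP[/dab/negP].
pose cut c (z : fconf X * fconf X * fconf X) : fconf X * fconf X * fconf X :=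
  (z.1.1 `&` c, z.1.2 `&` c, z.2 `&` c).
have cutE p q : p \in parts3 a -> q \in parts3 b ->
    p = cut a (join3 p q) /\ q = cut b (join3 p q).
  move: p q => [[x1 x2] x3] [[y1 y2] y3] /parts3_pointwise ha /parts3_pointwise hb.
  split; rewrite /cut /join3 /=; congr (_, _, _); apply/fsetP => x;
  rewrite !inE; move: (ha x) (hb x) (dab x) => [-> _ _ _] [-> _ _ _];
  by case: (x \in x1); case: (x \in x2); case: (x \in x3);
    case: (x \in y1); case: (x \in y2); case: (x \in y3).
apply: uniq_perm.
- exact: parts3_uniq.
- apply: allpairs_uniq; [exact: parts3_uniq|exact: parts3_uniq|].
  move=> [p q] [p' q'] /allpairsP[[u v] [/= pa qb [-> ->]]].
  move=> /allpairsP[[u' v'] [/= pa' qb' [-> ->]]] /= pq.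
  have [e1 e2] := cutE _ _ pa qb; have [e3 e4] := cutE _ _ pa' qb'.
  by congr pair; [rewrite e1 pq -e3|rewrite e2 pq -e4].
- move=> [[z1 z2] z3]; apply/idP/allpairsP.
    move=> /parts3_pointwise h.
    exists (cut a (z1, z2, z3), cut b (z1, z2, z3)); split => /=.
    + apply/parts3_pointwise => x; rewrite !inE.
      move: (h x) (dab x) => []; rewrite !inE.
      by case: (x \in z1); case: (x \in z2); case: (x \in z3);
        case: (x \in a); case: (x \in b).
    + apply/parts3_pointwise => x; rewrite !inE.
      move: (h x) (dab x) => []; rewrite !inE.
      by case: (x \in z1); case: (x \in z2); case: (x \in z3);
        case: (x \in a); case: (x \in b).
    + rewrite /cut /join3 /=; congr (_, _, _); apply/fsetP => x;
      rewrite !inE; move: (h x) (dab x) => []; rewrite !inE;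
      by case: (x \in z1); case: (x \in z2); case: (x \in z3);
        case: (x \in a); case: (x \in b).
  move=> [[[[x1 x2] x3] [[y1 y2] y3]] [/= /parts3_pointwise ha
    /parts3_pointwise hb [-> -> ->]]].
  apply/parts3_pointwise => x; rewrite !inE.
  move: (ha x) (hb x) (dab x) => [-> + + +] [-> + + +].
  by case: (x \in x1); case: (x \in x2); case: (x \in x3);
    case: (x \in y1); case: (x \in y2); case: (x \in y3).
Qed.

(** All the unions of parts met in the two-type convolution at a disjoint pair are
    again disjoint, so that [spread G] never vanishes there by default. *)
Lemma star2_conv_spread G a b : [disjoint a & b]%fset ->
  star2_conv (spread G) (spread G) (a, b) = star_conv G G (a `|` b).
Proof.
move=> dab; rewrite /star_conv (perm_big _ (parts3_fsetU dab)).
rewrite big_allpairs_dep /star2_conv /=.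
apply: eq_big_seq => -[[x1 x2] x3] xa; apply: eq_big_seq => -[[y1 y2] y3] yb.
have [xa1 xa2 xa3] := parts3_sub xa; have [yb1 yb2 yb3] := parts3_sub yb.
have dis (u v : fconf X) : u `<=` a -> v `<=` b -> [disjoint u & v]%fset.
  by move=> ua vb; apply: fdisjointWl ua _; apply: fdisjointWr vb _.
rewrite /spread /= !dis ?fsubUset ?xa1 ?xa2 ?xa3 ?yb1 ?yb2 ?yb3//.
congr (G _ * G _); apply/fsetP => x; rewrite !inE.
- by case: (x \in x1); case: (x \in x2); case: (x \in y1).
- by case: (x \in x2); case: (x \in x3); case: (x \in y2).
Qed.

Lemma sum_fpowerset_spread G k1 k2 (eta : fconf X) :
  \sum_(xi <- fpowerset eta)
    star2_conv (spread G) (spread G) (xi, eta `\` xi) *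
      (k1 xi * k2 (eta `\` xi)) =
  star_conv G G eta * ast_conv k1 k2 eta.
Proof.
rewrite /ast_conv mulr_sumr; apply: eq_big_seq => xi.
rewrite fpowersetE => xieta.
rewrite star2_conv_spread; last by apply/fdisjointP => x xxi; rewrite inE xxi.
congr (star_conv G G _ * _); apply/fsetP => x; rewrite !inE.
by have [/(fsubsetP xieta) ->|] := boolP (x \in xi).
Qed.

End spread.

(** The product sigma-algebra is contained in the Borel sigma-algebra of the
    product. *)
Lemma measurable_fun_borel_prod (A B : ptopologicalType) d (T : measurableType d)
    (f : borel A * borel B -> T) : measurable_fun setT f ->
  measurable_fun setT (f : borel (A * B)%type -> T).
Proof.
move=> mf.
have mfst : measurable_fun setT (fst : borel (A * B)%type -> borel A).
  apply: (@measurability _ _ _ (borel A) _ _ (@open A)) => // _ [U oU <-].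
  rewrite setTI; apply: sub_sigma_algebra.
  by apply: open_comp => // p _; exact: cvg_fst.
have msnd : measurable_fun setT (snd : borel (A * B)%type -> borel B).
  apply: (@measurability _ _ _ (borel B) _ _ (@open B)) => // _ [U oU <-].
  rewrite setTI; apply: sub_sigma_algebra.
  by apply: open_comp => // p _; exact: cvg_snd.
have mid : measurable_fun setT (fun p : borel (A * B)%type =>
    (p.1, p.2) : borel A * borel B) by exact: measurable_fun_pair.
rewrite (_ : f = f \o (fun p => (p.1, p.2))); first exact: measurableT_comp.
by apply/funext => -[].
Qed.

Section spread_measurable.
Variables (R : realType) (X : ptopologicalType) (V : nat -> set X).
Hypotheses (hX : hausdorff_space X) (bV : enum_basis V).
Local Notation conf := (borel (fconf X)).

(** Only measurability for the product sigma-algebra: this is what lifting to tuples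
    gives, and it is stronger than Borel measurability on the product. *)
Lemma measurable_spread (G : conf -> R) : measurable_fun setT G ->
  measurable_fun setT (spread G : conf * conf -> R).
Proof.
move=> mG; apply: (measurable_fun_fconf2 hX bV) => n p.
have mGs k : measurable_fun setT (fun t : k.-tuple (borel X) => G (@conf_of_seq X t)).
  exact: (measurableT_comp mG (@measurable_conf_of_seq _ _ hX bV k)).
pose T := (n.-tuple (borel X) * p.-tuple (borel X))%type.
have mu1 : measurable_fun setT (fun t : T => uniq t.1).
  exact: (measurableT_comp (@measurable_uniq _ _ hX bV n) measurable_fst).
have mu2 : measurable_fun setT (fun t : T => uniq t.2).
  exact: (measurableT_comp (@measurable_uniq _ _ hX bV p) measurable_snd).
have mcat : measurable_seq (n + p) (fun t : T => t.1 ++ t.2).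
  by apply: measurable_seq_cat; apply: measurable_seq_tuple.
have muc : measurable_fun setT (fun t : T => uniq (t.1 ++ t.2)).
  exact: (measurable_seq_comp (F := @uniq _) mcat
    (@measurable_uniq _ _ hX bV (n + p)%N)).
(* Repeated entries in one of the two tuples make the corresponding
   configuration empty, hence disjoint from the other one. *)
rewrite (_ : (fun _ => _) = (fun t : T =>
  if uniq t.1 then
    if uniq t.2 then
      if uniq (t.1 ++ t.2) then G (@conf_of_seq X (t.1 ++ t.2)) else 0
    else G (@conf_of_seq X t.1)
  else G (@conf_of_seq X t.2))).
  apply: measurable_fun_ifT => //.
    apply: measurable_fun_ifT => //.
      apply: measurable_fun_ifT => //.
      exact: (@measurable_seq_comp _ _ _ _ (borel X) _ _ _
        (fun s => G (@conf_of_seq X s)) mcat (mGs (n + p)%N)).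
    exact: (measurableT_comp (mGs n) measurable_fst).
  exact: (measurableT_comp (mGs p) measurable_snd).
apply/funext => -[s t] /=; rewrite /spread /=.
have [us|nus] := boolP (uniq s); last first.
  by rewrite /(conf_of_seq s) (negPf nus) fdisjoint0X fset0U.
have [ut|nut] := boolP (uniq t); last first.
  by rewrite /(conf_of_seq t) (negPf nut) fdisjointX0 fsetU0.
rewrite /conf_of_seq us ut cat_uniq us ut andbT /=.
have -> : ~~ has (in_mem^~ (mem (tval s))) t =
    [disjoint [fset x | x in tval s] & [fset x | x in tval t]]%fset.
  apply/hasPn/fdisjointP => h x.
    by rewrite !inE => xs; apply/negP => /h /=; rewrite xs.
  by move=> xt; apply/negP => /= xs; have := h x; rewrite !inE xs xt => /(_ erefl).
case: ifP => // _; congr G; apply/fsetP => x.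
by rewrite !inE ?mem_cat.
Qed.

Lemma Bbs_spread (G : fconf X -> R) : Bbs G -> Bbs2 (spread G).
Proof.
move=> [mG [M GM] [L [N [BL GL]]]]; split.
- exact: (measurable_fun_borel_prod (measurable_spread mG)).
- exists M => p; rewrite /spread; case: ifP => _; first exact: GM.
  by rewrite normr0; exact: le_trans (normr_ge0 _) (GM fset0).
- exists L, N; split => // p pLN; rewrite /spread; case: ifP => // _.
  apply: GL; apply: contra_not pLN => -[pL pN]; split; split.
  + by move=> x xp; apply: pL; rewrite /= inE xp.
  + exact: leq_trans (fsubset_leq_card (fsubsetUl _ _)) pN.
  + by move=> x xp; apply: pL; rewrite /= inE xp orbT.
  + exact: leq_trans (fsubset_leq_card (fsubsetUr _ _)) pN.
Qed.

End spread_measurable.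

(** * Transfer of positive definiteness *)

Section signed_convolution.
Variables (R : realType) (X : ptopologicalType).
Variable m : {sigma_finite_measure set (borel X) -> \bar R}.
Hypothesis m_atomless : non_atomic m.
Variable V : nat -> set X.
Hypotheses (hX : hausdorff_space X) (bV : enum_basis V).
Local Notation conf := (borel (fconf X)).
Local Notation lam := (lebesgue_poisson m).

(** The sum of [F] over the ways of splitting a configuration in two. *)
Definition sum_splittings (F : fconf X * fconf X -> R) (eta : fconf X) : R :=
  \sum_(xi <- fpowerset eta) F (xi, (eta `\` xi)%fset).

Lemma measurable_sum_splittings (F : conf * conf -> R) :
  measurable_fun setT F ->
  measurable_fun setT (sum_splittings F : conf -> R).
Proof.
move=> mF; apply/measurable_EFinP.
rewrite (_ : EFin \o _ = fun eta : conf =>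
  (\sum_(xi <- fpowerset (eta : fconf X)) (F (xi, (eta `\` xi)%fset))%:E)%R).
  apply: (measurable_sum_fpowerset hX bV (F := EFin \o F)).
  exact/measurable_EFinP.
by apply/funext => eta /=; rewrite -sumEFin.
Qed.

Lemma integral_sum_splittings_ge0 (F : conf * conf -> R) :
  measurable_fun setT F -> (forall p, 0 <= F p) ->
  (\int[lam]_eta (sum_splittings F eta)%:E = \int[lam \x lam]_p (F p)%:E)%E.
Proof.
move=> mF F0.
have := @lebesgue_poisson_convolution _ _ m m_atomless _ hX bV (EFin \o F).
have [mu -> _] := lebesgue_poisson_measure m_atomless hX bV.
move=> <- //; last exact/measurable_EFinP.
by apply: eq_integral => eta _; rewrite /sum_splittings -sumEFin.
Qed.

Lemma integral_sum_splittings (F : conf * conf -> R) :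
  (lam \x lam)%E.-integrable setT (EFin \o F) ->
  lam.-integrable setT (EFin \o sum_splittings F) /\
  (\int[lam]_eta (sum_splittings F eta)%:E = \int[lam \x lam]_p (F p)%:E)%E.
Proof.
have := integral_sum_splittings_ge0.
have [mu -> _] := lebesgue_poisson_measure m_atomless hX bV.
move=> minlos iF.
have mF : measurable_fun setT F by apply/measurable_EFinP; case/integrableP: iF.
pose P p := Num.max (F p) 0; pose N p : R := Num.max (- F p) 0.
have PE : EFin \o P = ((EFin \o F)^\+)%E.
  by apply/funext => p; rewrite funeposE /= EFin_max.
have NE : EFin \o N = ((EFin \o F)^\-)%E.
  by apply/funext => p; rewrite funenegE /= EFin_max.
have P0 p : 0 <= P p by rewrite le_max lexx orbT.
have N0 p : 0 <= N p by rewrite le_max lexx orbT.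
have iP : (mu \x mu)%E.-integrable setT (EFin \o P).
  by rewrite PE; exact: integrable_funepos.
have iN : (mu \x mu)%E.-integrable setT (EFin \o N).
  by rewrite NE; exact: integrable_funeneg.
have mP : measurable_fun setT P by apply/measurable_EFinP; case/integrableP: iP.
have mN : measurable_fun setT N by apply/measurable_EFinP; case/integrableP: iN.
have iS (Q : conf * conf -> R) : measurable_fun setT Q -> (forall p, 0 <= Q p) ->
    (mu \x mu)%E.-integrable setT (EFin \o Q) ->
    mu.-integrable setT (EFin \o sum_splittings Q).
  move=> mQ Q0 iQ; apply/integrableP; split.
    by apply/measurable_EFinP; exact: measurable_sum_splittings mQ.
  rewrite (eq_integral (fun eta : conf => (sum_splittings Q eta)%:E)); last first.
    by move=> eta _; rewrite /= ger0_norm// sumr_ge0.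
  rewrite minlos//; exact: integral_fune_lt_pinfty.
have SE : EFin \o sum_splittings F =
    ((EFin \o sum_splittings P) \- (EFin \o sum_splittings N))%E.
  apply/funext => eta /=; rewrite -EFinB /sum_splittings -sumrB.
  congr EFin; apply: eq_bigr => xi _; rewrite /P /N.
  case: (ltP 0 (F (xi, (eta `\` xi)%fset))) => F0.
    by rewrite max_r ?subr0// oppr_le0 ltW.
  by rewrite max_l ?sub0r ?opprK// oppr_ge0.
have iSP := iS _ mP P0 iP; have iSN := iS _ mN N0 iN.
split; first by rewrite SE; exact: integrableB.
transitivity (\int[mu]_eta ((EFin \o sum_splittings P) \-
    (EFin \o sum_splittings N)) eta)%E; first by rewrite -SE.
rewrite integralB//= !minlos//.
by rewrite [RHS]integralE -PE -NE.
Qed.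

End signed_convolution.

(** A Radon measure on a space exhausted by relatively compact Borel sets is
    sigma-finite. *)
Lemma radon_sigma_finite (R : realType) (X : ptopologicalType)
    (m : {measure set (borel X) -> \bar R}) (L : nat -> set X) :
  radon m -> (forall n, Bc (L n)) -> \bigcup_n L n = setT ->
  exists ms : {sigma_finite_measure set (borel X) -> \bar R},
    m = ms :> (set (borel X) -> \bar R).
Proof.
move=> m_radon BL LT.
have m_sfinite : sigma_finite setT m.
  exists L; first by rewrite LT.
  by move=> n; split; [case: (BL n)|exact: m_radon].
pose ms := HB.pack_for {sigma_finite_measure set (borel X) -> \bar R}
  (m : set _ -> \bar R) (Measure.class m)
  (@Measure_isSigmaFinite.Build _ _ _ (Measure.Pack (Measure.class m))
     m_sfinite).
by exists ms.
Qed.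

Theorem proposition5p12 (R : realType) (d : nat) (X : ptopologicalType)
  (M : oriented_riemannian_manifold R d X)
  (X_connected : connected [set: X])
  (X_noncompact : ~ compact [set: X])
  (m : {measure set (borel X) -> \bar R})
  (m_radon : radon m) (m_non_atomic : non_atomic m)
  (X_exhaustion : exists L : nat -> set X,
    [/\ forall n, Bc (L n), forall n, L n `<=` L n.+1 &
        \bigcup_n L n = [set: X]])
  (k1 k2 : fconf X -> R)
  (k1_measurable : measurable_fun setT (k1 : borel (fconf X) -> R))
  (k2_measurable : measurable_fun setT (k2 : borel (fconf X) -> R)) :
  star2_positive_definite m (fun eta => k1 eta.1 * k2 eta.2) ->
  star_positive_definite m (ast_conv k1 k2).
Proof.
have [L [BL _ LT]] := X_exhaustion.
have [ms mE] := radon_sigma_finite m_radon BL LT.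
rewrite mE in m_non_atomic *.
have hX := mfd_hausdorff M.
have [V bV] := second_countable_enum (mfd_second_countable M).
move=> [_ k_pd]; split.
  apply: (measurable_sum_splittings hX bV
    (F := fun p : borel (fconf X) * borel (fconf X) => k1 p.1 * k2 p.2)).
  by apply: measurable_funM; exact: measurableT_comp.
move=> G BG; have [iF F0] := k_pd _ (Bbs_spread hX bV BG).
pose F p := star2_conv (spread G) (spread G) p * (k1 p.1 * k2 p.2).
have FE : (fun eta => (star_conv G G eta * ast_conv k1 k2 eta)%:E) =
    EFin \o sum_splittings F.
  by apply/funext => eta /=; rewrite /sum_splittings sum_fpowerset_spread.
have [iS SE] := integral_sum_splittings m_non_atomic hX bV (F := F) iF.
by rewrite FE; split => //; rewrite /= SE.
Qed.
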